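(* For $s\in(1/2,1)$ let $\Phi_{n,s}(x)=\kappa_{n,s}|x|^{2s-n}$ with $\kappa_{n,s}=\Gamma\left(\frac{n-2s}{2}\right)/\bigl(2^{2s}\pi^{n/2}\Gamma(s)\bigr)$. As $s\uparrow1$ the following hold. (1) If $n\ge3$, then locally uniformly on $\mathbb R^n\setminus\{0\}$, $$\Phi_{n,s}(x)\to\Phi_{n,1}(x):=\frac{1}{(n-2)|S^{n-1}|}|x|^{2-n}.$$ For a compactly supported finite signed Radon measure $\mu$ on $\mathbb R^n$, the associated potentials $\int\Phi_{n,s}(x-y)\,d\mu(y)$ and gradients $\int\nabla\Phi_{n,s}(x-y)\,d\mu(y)$ therefore converge, locally uniformly outside $\operatorname{supp}\mu$, to $\int\Phi_{n,1}(x-y)\,d\mu(y)$ and $\int\nabla\Phi_{n,1}(x-y)\,d\mu(y)$. At a point $x\in\operatorname{supp}\mu$, the convergence at $x$ of the potentials, respectively of the gradients, holds if for some $\delta\in(0,1)$ $$\mathbf I_{2-\delta}^{|\mu|}(x)<\infty,\qquad\text{respectively}\qquad\mathbf I_{1-\delta}^{|\mu|}(x)<\infty.$$ (2) If $n=2$, then there is a constant $c_0\in\mathbb R$ such that, locally uniformly on $\mathbb R^2\setminus\{0\}$, $$\Phi_{2,s}(x)-\frac{1}{4\pi(1-s)}\to-\frac1{2\pi}\log|x|+c_0,$$ while $$\nabla\Phi_{2,s}(x)\to-\frac1{2\pi}\frac{x}{|x|^2}.$$ (Thus the gradient estimate, of order $2s-1$, converges to an estimate of order $1$, whereas the solution requires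 a logarithmic potential after fixing an additive normalization.) (3) The weak gradient exponent satisfies $$\frac{n}{n-2s+1}\to\frac{n}{n-1}.$$
   Context: $n\ge2$ throughout. For $0<\beta<n$, $\mathbf I_\beta^{|\mu|}(x)=\int_0^\infty\frac{|\mu|(B_\rho(x))}{\rho^{n-\beta}}\frac{d\rho}{\rho}$, where $|\mu|$ is the total variation of $\mu$. $|S^{n-1}|$ is the surface area of the unit sphere. The function $\Phi_{n,s}$ is the fundamental solution of $(-\Delta)^s$ normalized to have Fourier symbol $|\xi|^{2s}$. The statements concern normalized kernels, potential orders and mapping exponents only; no uniform boundedness of estimate constants as $s\uparrow1$ is asserted. *)

(* Defs.v *)
From HB Require Import structures.
From mathcomp Require Import all_boot all_order all_algebra.
From mathcomp Require Import all_classical all_reals all_analysis.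

Set Implicit Arguments.
Unset Strict Implicit.
Unset Printing Implicit Defensive.

Import Order.TTheory GRing.Theory Num.Theory.
Import numFieldNormedType.Exports.

Local Open Scope classical_set_scope.
Local Open Scope ring_scope.

Section euclidean.
Context {R : realType}.

(* The library norm on 'rV[R]_n is the sup norm; it induces the same topology
   (and Borel sets) as the Euclidean norm. *)
Definition enorm n (x : 'rV[R]_n) : R := Num.sqrt (\sum_(i < n) x ord0 i ^+ 2).

Definition eball n (x : 'rV[R]_n) (r : R) : set 'rV[R]_n :=
  [set y | enorm (y - x) < r].

Definition grad n (f : 'rV[R]_n -> R) (x : 'rV[R]_n) : 'rV[R]_n :=
  \row_(i < n) 'D_(delta_mx ord0 i) f x.

(* n-dimensional Lebesgue measure of Borel sets, as the n-fold iterate of the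
   product-measure formula (m1 \x m2) A = \int m2 (xsection A t) dm1(t). *)
Fixpoint lebesgue_rV n : set 'rV[R]_n -> \bar R :=
  match n return set 'rV[R]_n -> \bar R with
  | 0%N => fun A => (\1_A (0 : 'rV[R]_0))%:E
  | m.+1 => fun A => (\int[lebesgue_measure]_(t in [set: R])
      lebesgue_rV [set v : 'rV[R]_m | A (row_mx (t%:M : 'rV[R]_1) v)])%E
  end.

Definition cone_over n (A : set 'rV[R]_n) : set 'rV[R]_n :=
  [set x | exists r u, [/\ 0 < r <= 1, A u & x = r *: u]].

(* Surface measure of a part A of the unit sphere: n times the volume of the
   cone over A (the definition by polar coordinates). *)
Definition surface_measure n (A : set 'rV[R]_n) : \bar R :=
  (n%:R%:E * lebesgue_rV (cone_over A))%E.

(* |S^(n-1)| *)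
Definition sphere_area n : R :=
  fine (surface_measure [set u : 'rV[R]_n | enorm u = 1]).

End euclidean.

Section kernels.
Context {R : realType}.

Definition Gamma (a : R) : R :=
  \int[lebesgue_measure]_(t in `]0, +oo[) (t `^ (a - 1) * expR (- t)).

Definition kappa (n : nat) (s : R) : R :=
  Gamma ((n%:R - 2 * s) / 2) / (2 `^ (2 * s) * pi `^ (n%:R / 2) * Gamma s).

(* powR maps 0 to 0 for nonzero exponents, so these kernels take the value 0 at
   the origin instead of +oo. *)
Definition Phi (n : nat) (s : R) (x : 'rV[R]_n) : R :=
  kappa n s * enorm x `^ (2 * s - n%:R).

Definition Phi1 (n : nat) (x : 'rV[R]_n) : R :=
  1 / ((n%:R - 2) * @sphere_area R n) * enorm x `^ (2 - n%:R).

End kernels.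

(* R^n with its Borel sigma-algebra.  A charge on it is a finite signed Borel
   measure, which on R^n is automatically Radon. *)
Notation borel_rV R n := (g_sigma_algebraType (@open 'rV[R]_n)).

Section signed_measures.
Context d (T : measurableType d) (R : realType).
Variable mu : {charge set T -> \bar R}.

Definition hahn_pos : set T := sval (cid (Hahn_decomposition mu)).
Definition hahn_neg : set T := sval (cid (svalP (cid (Hahn_decomposition mu)))).

Lemma hahnP : hahn_decomposition mu hahn_pos hahn_neg.
Proof. exact: (svalP (cid (svalP (cid (Hahn_decomposition mu))))). Qed.

Definition total_variation : {measure set T -> \bar R} :=
  charge_variation hahnP.

Definition charge_integrable (f : T -> R) : Prop :=
  total_variation.-integrable [set: T] (EFin \o f).

(* Meaningful when charge_integrable f holds. *)
Definition charge_integral (f : T -> R) : R :=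
  \int[jordan_pos hahnP]_(y in [set: T]) f y -
  \int[jordan_neg hahnP]_(y in [set: T]) f y.

End signed_measures.

Section potentials.
Context {R : realType} {n : nat}.
Implicit Types mu : {charge set (borel_rV R n) -> \bar R}.

Definition supp mu : set 'rV[R]_n :=
  [set x | forall U : set 'rV[R]_n,
     open U -> U x -> (0 < total_variation mu U)%E].

(* I_beta^|mu| *)
Definition riesz (beta : R) mu (x : 'rV[R]_n) : \bar R :=
  (\int[lebesgue_measure]_(rho in `]0%R, +oo[)
     (total_variation mu (eball x rho) *
      ((rho `^ (n%:R - beta))^-1 / rho)%:E))%E.

Definition potential (K : 'rV[R]_n -> R) mu (x : 'rV[R]_n) : R :=
  charge_integral mu (fun y : 'rV[R]_n => K (x - y)).

Definition potential_exists (K : 'rV[R]_n -> R) mu (x : 'rV[R]_n) : Prop :=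
  charge_integrable mu (fun y : 'rV[R]_n => K (x - y)).

Definition vpotential (K : 'rV[R]_n -> 'rV[R]_n) mu (x : 'rV[R]_n) : 'rV[R]_n :=
  \row_(i < n) potential (fun z => K z ord0 i) mu x.

Definition vpotential_exists (K : 'rV[R]_n -> 'rV[R]_n) mu (x : 'rV[R]_n) : Prop :=
  forall i : 'I_n, potential_exists (fun z => K z ord0 i) mu x.

End potentials.

(* Main.v *)
(** As functions, [Phi1 n = Phi n 1] for [n >= 3]: this amounts to
    |S^(n-1)| = 2 pi^(n/2) / Gamma(n/2), which follows from slicing balls, from
    the Wallis recursion for the integrals of (r^2 - t^2)^(m/2) over [-r, r],
    and from Gamma(3/2) = sqrt(pi)/2. Part (1) is thus continuity in [s] at
    [s = 1].

    Locally uniform convergence is reduced to joint convergence in [(x, s)] at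
    each point of a compact set. Off the support of [mu], potentials only see the
    kernel on the compact set [x - supp mu], which avoids the origin. On the
    support, Tonelli's theorem turns finiteness of the Riesz potential of order
    [beta] into integrability of [|x - y|^(beta - n)]; the latter dominates the
    kernels for [s] close to 1.

    In the plane, [kappa 2 s = A(s) / (1 - s)] with [A] differentiable at 1 and
    [A(1) = 1 / (4 pi)], so that [c0 = - A'(1)]. *)

(* Two obstacles shape the argument. [powR] gives the kernels an arbitrary value at the origin, so
   estimates hold only off the point [y = x]; at a point of the support this is harmless because a
   finite Riesz potential of order below [n] also forces [[set x]] to be a null set. And for [s < 1]
   the kernels are more singular than their limit, so finiteness at the limiting order would not
   dominate them; the margin [delta] pays for this as soon as [s > 1 - delta / 2].

   In the plane the pole is removed by the identity A(s) |x|^(2s-2) / (1-s) - A(1) / (1-s) = A(s)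
   (|x|^(2s-2) - 1) / (1-s) + (A(s) - A(1)) / (1-s). The first term tends to - 2 A(1) log |x|, the
   second to - A'(1). This is why Gamma is shown to be differentiable and not only continuous. *)
From HB Require Import structures.
Require Import Defs.
From mathcomp Require Import all_boot all_order all_algebra.
From mathcomp Require Import all_classical all_reals all_analysis.
From mathcomp Require Import measurable_realfun ring lra.

Set Implicit Arguments.
Unset Strict Implicit.
Unset Printing Implicit Defensive.

Import Order.TTheory GRing.Theory Num.Theory.
Import numFieldNormedType.Exports.

Local Open Scope classical_set_scope.
Local Open Scope ring_scope.

(** * The Gamma function *)

Section improper_FTC.
Context {R : realType}.
Notation mu := (@lebesgue_measure R).

(** A compact exhaustion of the open half-line. The right end [k.+2] keeps even the first interval
    [[1, 2]] nondegenerate, as [continuous_FTC2] requires. *)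
Let I_ (k : nat) : set R := `[k.+1%:R^-1, k.+2%:R].

Let I_pos k (x : R) : I_ k x -> 0 < x.
Proof. by rewrite /I_/= in_itv/= => /andP[+ _]; apply: lt_le_trans. Qed.

Let I_nd : nondecreasing_seq I_.
Proof.
apply/nondecreasing_seqP => k; rewrite subsetEset => x; rewrite /I_/= !in_itv/=.
move=> /andP[kx xk]; apply/andP; split.
  by apply: le_trans kx; rewrite lef_pV2 ?posrE// ler_nat.
by apply: (le_trans xk); rewrite ler_nat.
Qed.

Let bigcup_I : \bigcup_k I_ k = `]0, +oo[%classic.
Proof.
apply/seteqP; split=> [x [k _ /I_pos]|x]; first by rewrite /= in_itv/= andbT.
rewrite /= in_itv/= andbT => x0; pose k := maxn (Num.truncn x) (Num.truncn x^-1).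
exists k => //; rewrite /I_/= in_itv/=; apply/andP; split.
  rewrite -[leRHS]invrK lef_pV2 ?posrE// ?invr_gt0//.
  rewrite (le_trans (ltW (truncnS_gt _)))// ler_nat ltnS.
  exact: leq_maxr.
rewrite (le_trans (ltW (truncnS_gt _)))// ler_nat ltnS.
by rewrite leqW// leq_maxl.
Qed.

Let integral_I (f F : R -> R) k :
  (forall x : R, 0 < x -> is_derive x 1 F (f x)) ->
  (forall x : R, 0 < x -> {for x, continuous f}) ->
  (\int[mu]_(x in I_ k) (f x)%:E = (F k.+2%:R - F k.+1%:R^-1)%:E)%E.
Proof.
move=> dF cf; have ab : k.+1%:R^-1 < k.+2%:R :> R.
  by rewrite (@le_lt_trans _ _ 1) ?invf_le1 ?ler1n ?ltr1n.
have cF x : 0 < x -> {for x, continuous F}.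
  move=> /dF dFx; apply: differentiable_continuous.
  exact/derivable1_diffP/ex_derive.
rewrite /I_ (continuous_FTC2 ab _ (F := F)) //.
- apply: continuous_in_subspaceT => x; rewrite inE => /I_pos; exact: cf.
- split.
  + move=> x; rewrite in_itv/= => /andP[kx _]; apply: ex_derive.
    by apply: dF; apply: lt_trans kx.
  + by apply: cvg_at_right_filter; apply: cF.
  + by apply: cvg_at_left_filter; apply: cF.
- move=> x; rewrite in_itv/= => /andP[kx _]; rewrite derive1E.
  have /dF dFx : 0 < x by apply: lt_trans kx.
  exact: derive_val.
Qed.

Let measurable_I (f : R -> R) :
  (forall x : R, 0 < x -> {for x, continuous f}) ->
  measurable_fun (`]0, +oo[ : set R) f.
Proof.
move=> cf; apply: open_continuous_measurable_fun; first exact: interval_open.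
by move=> x; rewrite inE/= in_itv/= andbT => /cf.
Qed.

Let cvg_integral_I (f : R -> R) :
  (forall x : R, 0 < x -> {for x, continuous f}) ->
  (forall x : R, 0 < x -> 0 <= f x) ->
  (\int[mu]_(x in I_ k) (f x)%:E @[k --> \oo] -->
   \int[mu]_(x in `]0%R, +oo[) (f x)%:E)%E.
Proof.
move=> cf f0; rewrite -bigcup_I; apply: ge0_nondecreasing_set_cvg_integral.
- exact: I_nd.
- by move=> i; exact: measurable_itv.
- move=> i; apply/measurable_EFinP; apply: measurable_funS (measurable_I cf).
    exact: measurable_itv.
  by move=> x /I_pos; rewrite /= in_itv/= andbT.
- by move=> i x /I_pos x0; rewrite lee_fin f0.
Qed.

(** By the fundamental theorem the integrals over the intervals [I_ k] are at most [M + M]; monotone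
    convergence carries the bound to the half-line. *)
Lemma integrable_of_primitive (f F : R -> R) (M : R) :
  (forall x : R, 0 < x -> 0 <= f x) ->
  (forall x : R, 0 < x -> {for x, continuous f}) ->
  (forall x : R, 0 < x -> is_derive x 1 F (f x)) ->
  (forall x : R, 0 < x -> `|F x| <= M) ->
  mu.-integrable `]0, +oo[ (EFin \o f).
Proof.
move=> f0 cf dF FM; apply/integrableP; split.
  by apply/measurable_EFinP; exact: measurable_I.
rewrite [ltLHS](_ : _ = \int[mu]_(x in `]0%R, +oo[) (f x)%:E)%E; last first.
  apply: eq_integral => x; rewrite inE/= in_itv/= andbT => x0.
  by rewrite ger0_norm ?f0.
apply: (@le_lt_trans _ _ (M + M)%:E); last exact: ltry.
apply: (cvge_le _ (cvg_integral_I cf f0)); apply: nearW => k.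
rewrite (integral_I _ dF cf) lee_fin (le_trans (ler_norm _))//.
by rewrite (le_trans (ler_normB _ _))// lerD// FM.
Qed.

(** Shaped for integration by parts: the derivative of a product appears as a difference of two
    nonnegative integrands, so monotone convergence applies to each of them. *)
Lemma improper_FTC2 (f g F : R -> R) (l0 l : R) :
  (forall x : R, 0 < x -> 0 <= f x) -> (forall x : R, 0 < x -> 0 <= g x) ->
  (forall x : R, 0 < x -> {for x, continuous f}) ->
  (forall x : R, 0 < x -> {for x, continuous g}) ->
  (forall x : R, 0 < x -> is_derive x 1 F (f x - g x)) ->
  F x @[x --> 0^'+] --> l0 -> F x @[x --> +oo] --> l ->
  mu.-integrable `]0, +oo[ (EFin \o f) -> mu.-integrable `]0, +oo[ (EFin \o g) ->
  \int[mu]_(x in `]0, +oo[) f x - \int[mu]_(x in `]0, +oo[) g x = l - l0.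
Proof.
move=> f0 g0 cf cg dF Fl0 Fl intf intg.
have cfg x : 0 < x -> {for x, continuous (fun x => f x - g x)}.
  by move=> x0; apply: continuousB; [exact: cf|exact: cg].
have intI k (h : R -> R) : (forall x : R, 0 < x -> {for x, continuous h}) ->
    mu.-integrable (I_ k) (EFin \o h).
  move=> ch; apply: continuous_compact_integrable; first exact: segment_compact.
  by apply: continuous_in_subspaceT => x; rewrite inE => /I_pos; exact: ch.
have fineI (h : R -> R) : (forall x : R, 0 < x -> {for x, continuous h}) ->
    (forall x : R, 0 < x -> 0 <= h x) -> mu.-integrable `]0, +oo[ (EFin \o h) ->
    \int[mu]_(x in I_ k) h x @[k --> \oo] --> \int[mu]_(x in `]0, +oo[) h x.
  move=> ch h0 inth; rewrite /Rintegral; apply: fine_cvg.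
  rewrite fineK; first exact: cvg_integral_I.
  exact: integrable_fin_num.
have L1 : \int[mu]_(x in I_ k) f x - \int[mu]_(x in I_ k) g x @[k --> \oo] -->
    \int[mu]_(x in `]0, +oo[) f x - \int[mu]_(x in `]0, +oo[) g x.
  by apply: cvgB; apply: fineI.
have natoo : (k.+2%:R : R) @[k --> \oo] --> +oo.
  apply/cvgryPge => r; near=> k; rewrite (@le_trans _ _ k%:R)//.
    by near: k; exact: nbhs_infty_ger.
  by rewrite ler_nat; apply: leqW.
have L2 : F k.+2%:R - F (k.+1%:R^-1) @[k --> \oo] --> l - l0.
  apply: cvgB; first by move/cvg_pinftyP : Fl; apply.
  by move/cvg_at_rightP : Fl0; apply; split => //; exact: cvg_harmonic.
apply: (cvg_unique _ L1); rewrite //=.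
rewrite (_ : (fun k => _) = (fun k => F k.+2%:R - F (k.+1%:R^-1)))//.
apply/funext => k; rewrite -RintegralB//; last 3 first.
- exact: measurable_itv.
- exact: intI.
- exact: intI.
by rewrite /Rintegral (integral_I _ dF cfg).
Unshelve. all: by end_near. Qed.

End improper_FTC.

Section Gamma_function.
Context {R : realType}.
Implicit Types a b t : R.
Notation mu := (@lebesgue_measure R).

(** Raise [t / b <= expR (t / b)] to the power [b]. *)
Lemma powR_le_expR b t : 0 < b -> 0 < t -> t `^ b <= b `^ b * expR t.
Proof.
move=> b0 t0; have tE : t = t / b * b by rewrite divfK ?gt_eqF.
rewrite [X in X `^ _ <= _]tE mulrC powRM ?divr_ge0 ?(ltW t0) ?(ltW b0)//.
rewrite ler_wpM2l ?powR_ge0// [X in expR X]tE expRM.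
rewrite ge0_ler_powR ?nnegrE ?expR_ge0 ?divr_ge0 ?(ltW t0) ?(ltW b0)//.
by apply: le_trans (expR_ge1Dx _); rewrite lerDr.
Qed.

Lemma continuous_powR a t : 0 < t -> {for t, continuous (fun x : R => x `^ a)}.
Proof.
move=> t0; apply/differentiable_continuous/derivable1_diffP/ex_derive.
exact: is_derive1_powR.
Qed.

Definition Gamma_integrand a t := t `^ (a - 1) * expR (- t).

Lemma Gamma_integrand_ge0 a t : 0 <= Gamma_integrand a t.
Proof. by rewrite mulr_ge0 ?powR_ge0 ?expR_ge0. Qed.

Lemma continuous_expRN t : {for t, continuous (fun x : R => expR (- x))}.
Proof.
apply: (@continuous_comp _ _ _ -%R expR); first exact: continuousN.
exact: continuous_expR.
Qed.

Lemma continuous_Gamma_integrand a t :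
  0 < t -> {for t, continuous (Gamma_integrand a)}.
Proof.
by move=> t0; apply: continuousM; [exact: continuous_powR|exact: continuous_expRN].
Qed.

Lemma integrable_Gamma_integrand a : 0 < a ->
  mu.-integrable `]0, +oo[ (EFin \o Gamma_integrand a).
Proof.
(* Compare with the derivative of [t^a / (1 + t^a)], up to a factor [a]. *)
move=> a0; pose f t := t `^ (a - 1) / (1 + t `^ a) ^+ 2.
have D0 t : 0 < 1 + t `^ a by rewrite ltr_pwDl// powR_ge0.
have mf : measurable_fun (`]0, +oo[ : set R) (Gamma_integrand a).
  apply: open_continuous_measurable_fun; first exact: interval_open.
  by move=> x; rewrite inE/= in_itv/= andbT; exact: continuous_Gamma_integrand.
have intf : mu.-integrable `]0, +oo[ (EFin \o f).
  apply: (@integrable_of_primitive _ _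
    (fun t => - a^-1 * (1 + t `^ a)^-1) a^-1).
  - by move=> t t0; rewrite divr_ge0 ?powR_ge0 ?sqr_ge0.
  - move=> t t0; apply: continuousM; first exact: continuous_powR.
    apply: continuousV; first by rewrite sqrf_eq0 gt_eqF.
    apply: (@continuous_comp _ _ _ (fun t => 1 + t `^ a) (fun x => x ^+ 2)).
      by apply: continuousD; [exact: cst_continuous|exact: continuous_powR].
    exact: exprn_continuous.
  - move=> t t0.
    have d1 : is_derive t 1 (fun t => 1 + t `^ a) (a * t `^ (a - 1)).
      rewrite -[X in is_derive _ _ _ X]add0r; apply: is_deriveD.
      exact: is_derive1_powR.
    have d2 : is_derive t 1 (fun t => (1 + t `^ a)^-1)
        (- (1 + t `^ a) ^- 2 *: (a * t `^ (a - 1))).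
      by apply: is_deriveV; rewrite gt_eqF.
    apply: (is_derive_eq (is_deriveZ (- a^-1) d2)).
    by rewrite /f /GRing.scale/=; field; rewrite !gt_eqF.
  - move=> t t0; rewrite normrM normrN !ger0_norm ?invr_ge0 ?(ltW a0) ?(ltW (D0 t))//.
    by rewrite ler_piMr ?invr_ge0 ?(ltW a0)// invf_le1// lerDl powR_ge0.
(* The constant comes from [(1 + t^a)^2 <= 2 + 2 t^(2a)], where [powR_le_expR] bounds [t^(2a)] by
   [(2a)^(2a) * expR t], and 1 is at most [expR t]. *)
pose C := 2 + 2 * (2 * a) `^ (2 * a).
apply: (le_integrable _ _ _ (integrableZl _ C intf)) => //.
- exact/measurable_EFinP.
- move=> t /=; rewrite in_itv/= andbT => t0.
  rewrite lee_fin ger0_norm ?Gamma_integrand_ge0//.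
  apply: le_trans (ler_norm _).
  rewrite /f /Gamma_integrand mulrCA ler_wpM2l ?powR_ge0//.
  rewrite ler_pdivlMr ?exprn_gt0// mulrC expRN ler_pdivrMr ?expR_gt0//.
  have A : t `^ a ^+ 2 <= (2 * a) `^ (2 * a) * expR t.
    rewrite -powR_mulrn ?powR_ge0// -powRrM mulrC.
    by apply: powR_le_expR; rewrite ?mulr_gt0.
  have B : 1 <= expR t by apply: le_trans (expR_ge1Dx _); rewrite lerDl (ltW t0).
  have := sqr_ge0 (1 - t `^ a); rewrite /C; nra.
Qed.

(** Integration by parts: the primitive [F] vanishes at both ends of the half-line. *)
Lemma GammaS a : 0 < a -> Gamma (a + 1) = a * Gamma a.
Proof.
move=> a0; have a10 : 0 < a + 1 by rewrite addr_gt0.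
pose F t := t `^ a * expR (- t).
have F0 : F t @[t --> 0^'+] --> 0.
  rewrite -[X in _ --> X](mul0r (expR (- 0))); apply: cvgM; first exact: powR_cvg0.
  by apply: cvg_at_right_filter; exact: continuous_expRN.
have Foo : F t @[t --> +oo] --> 0.
  (* [powR_le_expR] with exponent [a + 1] gives [t * F t <= C]. *)
  pose C := (a + 1) `^ (a + 1).
  apply: (@squeeze_cvgr _ _ _ _ (cst 0) (fun t => C * t^-1)).
  - near=> t; have t0 : 0 < t by near: t; exact: nbhs_pinfty_gt.
    rewrite /F mulr_ge0 ?powR_ge0 ?expR_ge0//= ler_pdivlMr//.
    rewrite mulrAC expRN ler_pdivrMr ?expR_gt0//.
    rewrite -[X in _ * X <= _](powRr1 (ltW t0)) -powRD.
      exact: powR_le_expR.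
    by rewrite (gt_eqF t0) implybT.
  - exact: cvg_cst.
  - rewrite -[X in _ --> X](mulr0 C); apply: cvgM; first exact: cvg_cst.
    by apply/gtr0_cvgV0 => //; near=> t; near: t; exact: nbhs_pinfty_gt.
have := @improper_FTC2 _ (fun t => a * Gamma_integrand a t)
  (Gamma_integrand (a + 1)) F 0 0.
rewrite subrr RintegralZl//; last exact: integrable_Gamma_integrand.
rewrite /Gamma => H; apply/esym/eqP; rewrite -subr_eq0; apply/eqP; apply: H => //.
- by move=> t _; rewrite mulr_ge0 ?Gamma_integrand_ge0// (ltW a0).
- by move=> t _; exact: Gamma_integrand_ge0.
- move=> t t0; apply: continuousM; first exact: cst_continuous.
  exact: continuous_Gamma_integrand.
- by move=> t t0; exact: continuous_Gamma_integrand.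
- move=> t t0.
  have d1 := is_derive1_powR a t0.
  have d2 : is_derive t 1 (fun t => expR (- t)) (- expR (- t)).
    rewrite -mulrN1; apply: (@is_derive1_comp _ expR -%R).
  apply: (is_derive_eq (is_deriveM d1 d2)).
  by rewrite /Gamma_integrand addrK /GRing.scale/=; ring.
- exact: (integrableZl _ a (integrable_Gamma_integrand a0)).
- exact: integrable_Gamma_integrand.
Unshelve. all: by end_near. Qed.

Lemma Gamma1 : Gamma 1 = 1 :> R.
Proof.
have d t : is_derive t 1 (fun t => - expR (- t)) (expR (- t)).
  have d1 : is_derive t 1 (fun t => expR (- t)) (expR (- t) * -1).
    exact: (@is_derive1_comp _ expR -%R).
  by apply: (is_derive_eq (is_deriveN d1)); rewrite mulrN1 opprK.
have e : Gamma_integrand 1 = fun t => expR (- t).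
  by apply/funext => t; rewrite /Gamma_integrand subrr powRr0 mul1r.
have := @improper_FTC2 _ (Gamma_integrand 1) (cst 0) (fun t => - expR (- t)) (-1) 0.
rewrite Rintegral_cst// mul0r subr0 sub0r opprK; apply => //.
- by move=> t _; exact: Gamma_integrand_ge0.
- by move=> t t0; exact: continuous_Gamma_integrand.
- by move=> t _; exact: cst_continuous.
- by move=> t _; rewrite e subr0.
- rewrite -[in X in _ --> X]expR0 -[X in expR X]oppr0.
  by apply: cvgN; apply: cvg_at_right_filter; exact: continuous_expRN.
- by rewrite -[X in _ --> X]oppr0; apply: cvgN; exact: cvgr_expR.
- exact: integrable_Gamma_integrand.
- exact: integrable0.
Qed.


(** The logarithm lies below the identity; apply this to [t^e] for the upper bound and to [t^(-e)]
    for the lower one. *)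
Lemma normr_ln_le (e t : R) : 0 < e -> 0 < t -> `|ln t| <= e^-1 * (t `^ e + t `^ (- e)).
Proof.
move=> e0 t0; have H (x : R) : 0 < x -> ln x <= e^-1 * x `^ e.
  move=> x0; rewrite mulrC ler_pdivlMr// mulrC -ln_powR.
  by rewrite ltW// ln_sublinear// powR_gt0.
have := H _ t0; have := H t^-1.
rewrite invr_gt0 lnV ?posrE// -(powR_inv1 (ltW t0)) -powRrM mulN1r => /(_ t0).
have := powR_ge0 t e; have := powR_ge0 t (- e).
move=> A B C D; rewrite mulrDr ler_norml; apply/andP; split.
  rewrite lerNl (le_trans C)// lerDr mulr_ge0// invr_ge0 ltW//.
by rewrite (le_trans D)// lerDl mulr_ge0// invr_ge0 (ltW e0).
Qed.

(** A power is monotone in its exponent, in a direction that depends on whether [t >= 1]; the sum of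
    the two ends covers both cases. It provides majorants independent of the exponent. *)
Lemma powR_le_ends (u v a t : R) : 0 < t -> u <= a <= v ->
  t `^ a <= t `^ u + t `^ v.
Proof.
move=> t0 /andP[ua av]; have [t1|t1] := leP 1 t.
  by rewrite (le_trans (ler_powR t1 av))// lerDr powR_ge0.
by rewrite (le_trans (ger_powR _ ua)) ?t0 ?(ltW t1)// lerDl powR_ge0.
Qed.

Lemma is_derive_powR_exponent (a c t : R) : 0 < t ->
  is_derive a 1 (fun x : R => t `^ (x - c)) (t `^ (a - c) * ln t).
Proof.
move=> t0; have tn : t != 0 by rewrite gt_eqF.
have -> : (fun x : R => t `^ (x - c)) = expR \o (fun x => (x - c) * ln t).
  by apply/funext => x /=; rewrite /powR (negbTE tn).
have d1 : is_derive a 1 (fun x => (x - c) * ln t) (ln t).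
  have d : is_derive a 1 (fun x : R => x - c) 1.
    by apply: (is_derive_eq (is_deriveB _ _)); rewrite subr0.
  apply: (is_derive_eq (is_deriveM d (is_derive_cst (ln t) a 1))).
  by rewrite scaler0 add0r /GRing.scale/= mulr1.
apply: (is_derive_eq (is_derive1_comp (is_derive_expR _) d1)).
by rewrite /powR (negbTE tn).
Qed.

Lemma derivable_Gamma a : 0 < a -> derivable (@Gamma R) a 1.
Proof.
(* The logarithm in the derivative is absorbed by shifting exponents by [e]. With [e = a / 4] the
   smallest resulting exponent, [u - e = a / 4], is positive, so every term of the majorant [G] is
   an integrable Gamma integrand. *)
move=> a0; pose u := a / 2; pose v := a + 1; pose e := a / 4.
pose g b t := Gamma_integrand b t.
pose G t := e^-1 * (g (u + e) t + g (v + e) t + (g (u - e) t + g (v - e) t)).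
have u0 : 0 < u by rewrite divr_gt0.
have v0 : 0 < v by rewrite addr_gt0.
have e0 : 0 < e by rewrite divr_gt0.
have derg b t : 0 < t ->
    is_derive b 1 (fun x => Gamma_integrand x t) (t `^ (b - 1) * ln t * expR (- t)).
  move=> t0; apply: (is_derive_eq
    (is_deriveM (is_derive_powR_exponent b 1 t0) (is_derive_cst (expR (- t)) b 1))).
  by rewrite scaler0 add0r /GRing.scale/= mulrC.
have ig b : 0 < b -> mu.-integrable `]0, +oo[ (EFin \o g b).
  exact: integrable_Gamma_integrand.
apply: (@derivable_under_integral _ _ _ mu (fun b t => Gamma_integrand b t)
  `]0, +oo[%classic _ a u v _ _ _ G).
- exact: measurable_itv.
- by rewrite /= in_itv/=; apply/andP; split; rewrite /u /v; lra.
- move=> x; rewrite /= in_itv/= => /andP[ux _].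
  by apply: integrable_Gamma_integrand; exact: lt_trans ux.
- move=> x t _; rewrite /= in_itv/= andbT => t0.
  by have [] := derg x t t0.
- move=> t; rewrite mulr_ge0 ?invr_ge0 ?(ltW e0)//.
  by rewrite !addr_ge0 ?Gamma_integrand_ge0.
- have i1 : mu.-integrable `]0, +oo[ (EFin \o g (u + e)) by apply: ig; rewrite addr_gt0.
  have i2 : mu.-integrable `]0, +oo[ (EFin \o g (v + e)) by apply: ig; rewrite addr_gt0.
  have i3 : mu.-integrable `]0, +oo[ (EFin \o g (u - e)) by apply: ig; rewrite /u /e; lra.
  have i4 : mu.-integrable `]0, +oo[ (EFin \o g (v - e)) by apply: ig; rewrite /v /e; lra.
  exact: (integrableZl _ e^-1
    (integrableD _ (integrableD _ i1 i2) (integrableD _ i3 i4))).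
- move=> x t; rewrite /= !in_itv/= andbT => /andP[ux xv] t0.
  rewrite partial1of2E (@derive_val _ _ _ _ _ _ _ (derg x t t0)).
  rewrite !normrM !(ger0_norm (powR_ge0 _ _)) (ger0_norm (expR_ge0 _)).
  have A := normr_ln_le e0 t0.
  have B : t `^ (x - 1) <= t `^ (u - 1) + t `^ (v - 1).
    by apply: powR_le_ends => //; rewrite !lerD2r (ltW ux) (ltW xv).
  have tD b c : t `^ (b + c - 1) = t `^ (b - 1) * t `^ c.
    by rewrite -powRD ?(gt_eqF t0) ?implybT// addrAC.
  apply: (@le_trans _ _ ((t `^ (u - 1) + t `^ (v - 1)) *
                         (e^-1 * (t `^ e + t `^ (- e))) * expR (- t))).
    by rewrite ler_wpM2r ?expR_ge0// ler_pM ?powR_ge0.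
  rewrite /G /g /Gamma_integrand !tD le_eqVlt; apply/orP; left; apply/eqP; ring.
Qed.

Lemma continuous_Gamma a : 0 < a -> {for a, continuous (@Gamma R)}.
Proof.
by move=> a0; apply/differentiable_continuous/derivable1_diffP/derivable_Gamma.
Qed.

Let bigcup_itv0 (f : nat -> R) : (forall k, k%:R <= f k) ->
  \bigcup_k `[0, f k]%classic = `[0, +oo[%classic.
Proof.
move=> f_ge; apply/seteqP; split=> [x [k _]|x]; rewrite /= !in_itv/=.
  by move=> /andP[-> _].
rewrite andbT => x0; exists (Num.truncn x).+1 => //=; rewrite in_itv/= x0/=.
by rewrite (le_trans (ltW (truncnS_gt x)))// f_ge.
Qed.

(** Substitute on [[0, k]] and let [k] grow; the images [[0, k^2]] exhaust the half-line as well,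
    since [k <= k^2]. *)
Lemma integral_substitution_sqr (G : R -> R) :
  continuous G -> (forall t, 0 <= t -> 0 <= G t) ->
  (\int[mu]_(t in `[0%R, +oo[) (G t)%:E =
   \int[mu]_(x in `[0%R, +oo[) (G (x ^+ 2) * (2 * x))%:E)%E.
Proof.
move=> cG G0; pose F x : R := x ^+ 2.
have dF (x : R) : is_derive x 1 F (2 * x).
  apply: (is_derive_eq (is_deriveM (is_derive_id x 1) (is_derive_id x 1))).
  by rewrite /GRing.scale/= mulr1 mulr_natl.
have dFE : derive1 F = fun x => 2 * x.
  by apply/funext => x; rewrite derive1E (@derive_val _ _ _ _ _ _ _ (dF x)).
have cF : continuous F by exact: exprn_continuous.
have cF' : continuous (fun x : R => 2 * x).
  by move=> x; apply: cvgM; [exact: cvg_cst|exact: cvg_id].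
have cH : continuous (fun x : R => G (x ^+ 2) * (2 * x)).
  move=> x; apply: cvgM; last exact: cF'.
  by apply: (@continuous_comp _ _ _ F G); [exact: cF|exact: cG].
have ndF (f : nat -> R) : {homo f : m n / (m <= n)%N >-> m <= n} ->
    nondecreasing_seq (fun k => `[0, f k]%classic : set R).
  move=> ndf m n mn; rewrite subsetEset => x /=; rewrite !in_itv/=.
  by move=> /andP[-> /le_trans]; apply; exact: ndf.
have K (H : R -> R) (f : nat -> R) : continuous H ->
    (forall t, 0 <= t -> 0 <= H t) -> {homo f : m n / (m <= n)%N >-> m <= n} ->
    (forall k, k%:R <= f k) ->
    (\int[mu]_(x in `[0%R, f k]) (H x)%:E @[k --> \oo] -->
     \int[mu]_(x in `[0%R, +oo[) (H x)%:E)%E.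
  move=> cH' H0 ndf f_ge; rewrite -(bigcup_itv0 f_ge).
  apply: ge0_nondecreasing_set_cvg_integral.
  - exact: ndF.
  - by move=> i; exact: measurable_itv.
  - move=> i; apply/measurable_EFinP/measurable_funTS.
    exact: continuous_measurable_fun.
  - by move=> i x /=; rewrite in_itv/= => /andP[x0 _]; rewrite lee_fin H0.
have K1 := K G (fun k => F k%:R) cG G0.
have K2 := K _ (fun k => k%:R) cH.
apply: (@cvg_unique _ _ _ _ _ _ (K1 _ _)) => //.
- by move=> m n mn; rewrite /F ler_sqr ?nnegrE// ler_nat.
- by move=> k; rewrite /F -natrX ler_nat; case: k => // k; rewrite -mulnn leq_pmulr.
rewrite (_ : (fun k => _) =
    (fun k => \int[mu]_(x in `[0%R, k%:R]) (G (x ^+ 2) * (2 * x))%:E)%E).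
  apply: K2 => [t t0|m n mn|k//]; last by rewrite ler_nat.
  by rewrite mulr_ge0 ?mulr_ge0 ?G0 ?sqr_ge0.
apply/funext => k; have F00 : F 0 = 0 by rewrite /F expr0n.
have := @integration_by_substitution_increasing R F G 0 k%:R (ler0n _ _).
rewrite F00 dFE; apply.
- move=> x y; rewrite !in_itv/= => /andP[x0 _] /andP[y0 _] xy.
  by rewrite /F ltr_sqr ?nnegrE.
- by move=> x _; exact: cF'.
- by apply/cvg_ex; eexists; apply: cvg_at_right_filter; exact: cF'.
- by apply/cvg_ex; eexists; apply: cvg_at_left_filter; exact: cF'.
- split.
  + by move=> x _; have [] := dF x.
  + by apply: cvg_at_right_filter; exact: cF.
  + by apply: cvg_at_left_filter; exact: cF.
- exact: continuous_subspaceT.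
Qed.

(** The argument 3/2 is preferred to 1/2 because its integrand is continuous at 0, as the
    substitution by squares demands. It starts the odd dimensions in [ball_volumeE]. *)
Lemma Gamma_3half : Gamma (3 / 2) = Num.sqrt pi / 2 :> R.
Proof.
pose G (t : R) := Num.sqrt t * expR (- t).
have cG : continuous G.
  by move=> x; apply: cvgM; [exact: sqrt_continuous|exact: continuous_expRN].
have G0 (t : R) : 0 <= G t by rewrite mulr_ge0 ?sqrtr_ge0 ?expR_ge0.
have cH : continuous (fun x : R => G (x ^+ 2) * (2 * x)).
  move=> x; apply: cvgM; last by apply: cvgM; [exact: cvg_cst|exact: cvg_id].
  by apply: (@continuous_comp _ _ _ (fun x : R => x ^+ 2) G);
    [exact: exprn_continuous|exact: cG].
pose f (x : R) := 2 * x ^+ 2 * expR (- x ^+ 2).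
have E : (\int[mu]_(x in `]0%R, +oo[) (Gamma_integrand (3 / 2) x)%:E =
          \int[mu]_(x in `]0%R, +oo[) (f x)%:E)%E.
  transitivity (\int[mu]_(x in `]0%R, +oo[) (G x)%:E)%E.
    apply: eq_integral => x; rewrite inE/= in_itv/= andbT => x0.
    rewrite /Gamma_integrand /G -powR12_sqrt ?(ltW x0)//; congr (_ `^ _ * _)%:E.
    by field.
  rewrite integral_itv_obnd_cbnd; last first.
    by apply/measurable_EFinP/measurable_funTS; exact: continuous_measurable_fun.
  rewrite (integral_substitution_sqr cG)// -integral_itv_obnd_cbnd.
    apply: eq_integral => x; rewrite inE/= in_itv/= andbT => x0.
    by rewrite /G sqrtr_sqr gtr0_norm// /f; congr EFin; ring.
  by apply/measurable_EFinP/measurable_funTS; exact: continuous_measurable_fun.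
(* Integrate by parts against the Gaussian, with primitive [- x exp(- x^2)]. *)
have -> : Gamma (3 / 2) = \int[mu]_(x in `]0, +oo[) f x by congr fine.
have cf : continuous f.
  move=> x; apply: cvgM; last exact: (@continuous_gauss_fun R).
  by apply: cvgM; [exact: cvg_cst|exact: exprn_continuous].
have f0 (x : R) : 0 <= f x.
  by apply: mulr_ge0; [apply: mulr_ge0; [|exact: sqr_ge0]|exact: expR_ge0].
have ig : mu.-integrable `]0, +oo[ (EFin \o gauss_fun).
  by apply: integrableS (@integrableT_gauss R); [exact: measurableT|exact: measurable_itv|].
(* Integrability of [f] is inherited from the Gamma integrand through [E]. *)
have if_ : mu.-integrable `]0, +oo[ (EFin \o f).
  apply/integrableP; split.
    by apply/measurable_EFinP/measurable_funTS; exact: continuous_measurable_fun.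
  rewrite [ltLHS](_ : _ = \int[mu]_(x in `]0%R, +oo[) (f x)%:E)%E; last first.
    by apply: eq_integral => x _; rewrite /= ger0_norm.
  rewrite -E ltey_eq integrable_fin_num//.
  by apply: integrable_Gamma_integrand; rewrite divr_gt0.
pose F (x : R) := - x * expR (- x ^+ 2).
have cF : continuous F.
  move=> x; apply: cvgM; last exact: continuous_gauss_fun.
  exact: continuousN.
have Foo : F x @[x --> +oo] --> 0.
  apply: (@squeeze_cvgr _ _ _ _ (fun t => - t^-1) (cst 0)).
  - near=> t; have t0 : 0 < t by near: t; exact: nbhs_pinfty_gt.
    rewrite /F mulNr lerN2 oppr_le0 mulr_ge0 ?expR_ge0 ?(ltW t0)// andbT.
    rewrite expRN ler_pdivrMr ?expR_gt0// mulrC ler_pdivlMr//.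
    by rewrite -expr2 (le_trans _ (expR_ge1Dx _))// lerDr.
  - rewrite -[X in _ --> X]oppr0; apply: cvgN; apply/gtr0_cvgV0 => //.
    by near=> t; near: t; exact: nbhs_pinfty_gt.
  - exact: cvg_cst.
have := @improper_FTC2 _ f gauss_fun F 0 0.
have gE : \int[mu]_(x in `]0, +oo[) gauss_fun x = Num.sqrt pi / 2.
  rewrite /Rintegral integral_itv_obnd_cbnd ?integral0y_gauss//.
  by apply/measurable_EFinP/measurable_funTS; exact: measurable_gauss_fun.
rewrite subrr gE => H; apply/eqP; rewrite -subr_eq0; apply/eqP; apply: H => //.
- by move=> x _; exact: gauss_fun_ge0.
- by move=> x _; exact: cf.
- by move=> x _; exact: (@continuous_gauss_fun R).
- move=> x _.
  have d1 : is_derive x 1 (fun x : R => - x ^+ 2) (- (2 * x)).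
    apply: is_deriveN; apply: (is_derive_eq (is_deriveM (is_derive_id x 1) (is_derive_id x 1))).
    by rewrite /GRing.scale/= mulr1 mulr_natl.
  have d2 := @is_derive1_comp _ expR (fun x : R => - x ^+ 2) x _ _ (is_derive_expR _) d1.
  apply: (is_derive_eq (is_deriveM (is_deriveN (is_derive_id x 1)) d2)).
  by rewrite /f /gauss_fun /GRing.scale/= fctE; ring.
- rewrite [X in _ --> X](_ : 0 = F 0); last by rewrite /F oppr0 mul0r.
  by apply: cvg_at_right_filter; exact: cF.
Unshelve. all: by end_near. Qed.

End Gamma_function.

(** * Compact convergence and the Euclidean norm *)

Section compact_convergence.
Context {R : realType}.

Lemma compactly_in_cvgP (T : topologicalType) (V : pseudoMetricNormedZmodType R)
    (A : set T) (I : Type) (F : set_system I) (g : I -> T -> V) (g0 : T -> V) :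
  Filter F ->
  {family compactly_in A, g @ F --> g0} <->
  (forall K, K `<=` A -> compact K -> forall e, 0 < e ->
     \forall i \near F, forall y, K y -> `|g0 y - g i y| < e).
Proof.
move=> FF; split=> [/fam_cvgP H K KA cK e e0|H].
  have /H/(_ [set h | forall y, K y -> `|g0 y - h y| < e]) := conj KA cK.
  apply; apply/uniform_nbhs; exists [set p : V * V | `|p.1 - p.2| < e]; split => //.
  by rewrite -entourage_ballE; exists e => //= p; rewrite -ball_normE.
apply/fam_cvgP => K [KA cK] P /uniform_nbhs[E [entE EP]].
move: entE; rewrite -entourage_ballE => -[e e0 eE].
apply: filterS (H K KA cK e e0) => i Hi; apply: EP => y Ky; apply: eE => /=.
by rewrite -ball_normE; exact: Hi.
Qed.

(** The near-covering form of compactness makes an estimate near each pair [(y, F)] uniform over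
    [K]. Continuity of [g0] is what allows [g0] to be evaluated at the moving point instead of at
    [y]. *)
Lemma joint_cvg_compactly_in (T : topologicalType) (V : pseudoMetricNormedZmodType R)
    (A : set T) (I : Type) (F : set_system I) (g : I -> T -> V) (g0 : T -> V) :
  Filter F ->
  (forall y, A y -> g0 x @[x --> y] --> g0 y) ->
  (forall y, A y -> g z.2 z.1 @[z --> filter_prod (nbhs y) F] --> g0 y) ->
  {family compactly_in A, g @ F --> g0}.
Proof.
move=> FF cg0 cg; apply/compactly_in_cvgP => K KA /compact_near_coveringP cK e e0.
apply: (cK I F (fun i y => `|g0 y - g i y| < e)) => y Ky.
have e2 : 0 < e / 2 by rewrite divr_gt0.
have /cvgrPdist_lt/(_ _ e2) H1 := cg _ (KA _ Ky).
have /cvgrPdist_lt/(_ _ e2) H2 := cg0 _ (KA _ Ky).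
have H3 : \forall z \near filter_prod (nbhs y) F, `|g0 y - g0 z.1| < e / 2.
  exact: (cvg_fst H2).
near=> z.
rewrite [e]splitr -(subrKA (g0 y)) (le_lt_trans (ler_normD _ _))// ltrD//.
  by rewrite distrC; near: z.
by near: z.
Unshelve. all: by end_near. Qed.

Lemma cvg_powR_joint (T : Type) (F : set_system T) (a p : T -> R) (a0 p0 : R) :
  Filter F -> 0 < a0 -> a @ F --> a0 -> p @ F --> p0 ->
  a x `^ p x @[x --> F] --> a0 `^ p0.
Proof.
move=> FF a0_gt0 ca cp.
have -> : a0 `^ p0 = expR (p0 * ln a0) by rewrite /powR gt_eqF.
apply: (@cvg_trans _ (expR (p x * ln (a x)) @[x --> F])).
  apply: near_eq_cvg; near=> x; rewrite /powR gt_eqF//.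
  by near: x; exact: (cvgr_gt a0).
apply: continuous_cvg; first exact: continuous_expR.
by apply: cvgM => //; apply: continuous_cvg => //; exact: continuous_ln.
Unshelve. all: by end_near. Qed.

End compact_convergence.

Section euclidean_norm.
Context {R : realType} {n : nat}.
Implicit Types x y : 'rV[R]_n.

Lemma sum_sqr_ge0 x : 0 <= \sum_(i < n) x ord0 i ^+ 2.
Proof. by apply: sumr_ge0 => i _; exact: sqr_ge0. Qed.

Lemma enorm_ge0 x : 0 <= enorm x.
Proof. exact: sqrtr_ge0. Qed.

Lemma sqr_enorm x : enorm x ^+ 2 = \sum_(i < n) x ord0 i ^+ 2.
Proof. by rewrite sqr_sqrtr// sum_sqr_ge0. Qed.

Lemma enorm_eq0 x : (enorm x == 0) = (x == 0).
Proof.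
apply/eqP/eqP => [x0|->].
  have := sqr_enorm x; rewrite x0 expr0n => /esym/psumr_eq0P H.
  apply/rowP => i; rewrite mxE; apply/eqP; rewrite -sqrf_eq0; apply/eqP.
  by apply: H => // j _; exact: sqr_ge0.
by rewrite /enorm big1 ?sqrtr0// => i _; rewrite mxE expr0n.
Qed.

Lemma enorm_gt0 x : (0 < enorm x) = (x != 0).
Proof. by rewrite lt_neqAle enorm_ge0 andbT eq_sym enorm_eq0. Qed.

Lemma enormZ (r : R) x : enorm (r *: x) = `|r| * enorm x.
Proof.
rewrite /enorm -sqrtr_sqr -sqrtrM ?sqr_ge0// mulr_sumr; congr Num.sqrt.
by apply: eq_bigr => i _; rewrite mxE exprMn.
Qed.

Lemma enormN x : enorm (- x) = enorm x.
Proof. by rewrite -scaleN1r enormZ normrN1 mul1r. Qed.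

Lemma coord_le_enorm x i : `|x ord0 i| <= enorm x.
Proof.
rewrite -sqrtr_sqr ler_sqrt ?sum_sqr_ge0// (bigD1 i)//= lerDl.
by apply: sumr_ge0 => j _; exact: sqr_ge0.
Qed.

Lemma continuous_enorm : continuous (@enorm R n).
Proof.
move=> x; apply: (@continuous_comp _ _ _ (fun y : 'rV[R]_n => \sum_(i < n) y ord0 i ^+ 2) Num.sqrt);
  last exact: sqrt_continuous.
apply: continuous_big => [|i _ {}x]; first exact: add_continuous.
apply: (@continuous_comp _ _ _ (fun y : 'rV[R]_n => y ord0 i) (fun x : R => x ^+ 2)).
  exact: coord_continuous.
exact: exprn_continuous.
Qed.

Lemma powR_enorm (p : R) x : enorm x `^ p = (\sum_(i < n) x ord0 i ^+ 2) `^ (p / 2).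
Proof. by rewrite /enorm -powR12_sqrt ?sum_sqr_ge0// -powRrM mulrC. Qed.

Lemma sum_sqr_line x i (h : R) :
  \sum_(j < n) (h *: delta_mx ord0 i + x) ord0 j ^+ 2 =
  \sum_(j < n) x ord0 j ^+ 2 + (2 * h * x ord0 i + h ^+ 2).
Proof.
rewrite (bigD1 i)//= [in RHS](bigD1 i)//= !mxE !eqxx/= mulr1.
rewrite (eq_bigr (fun j => x ord0 j ^+ 2)); first by ring.
by move=> j ji; rewrite !mxE eqxx (negbTE ji) mulr0 add0r.
Qed.

(** On the line through [x] in direction [i] the squared norm is a quadratic polynomial in [h],
    positive at [h = 0]; the kernel becomes the one-variable function [phi], a power of that
    polynomial. *)
Lemma is_derive_powR_enorm (c p : R) x i : x != 0 ->
  is_derive x (delta_mx ord0 i) (fun y => c * enorm y `^ p)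
    (c * p * enorm x `^ (p - 2) * x ord0 i).
Proof.
move=> x0; pose f y : R := c * enorm y `^ p.
pose S := \sum_(j < n) x ord0 j ^+ 2.
have S0 : 0 < S by rewrite /S -sqr_enorm exprn_gt0// enorm_gt0.
pose phi (h : R) := c * (S + (2 * h * x ord0 i + h ^+ 2)) `^ (p / 2).
have fphi : (fun h : R => f (h *: delta_mx ord0 i + x)) = phi.
  by apply/funext => h; rewrite /f powR_enorm sum_sqr_line.
have dphi : is_derive (0 : R) 1 phi (c * (p / 2 * S `^ (p / 2 - 1) * (2 * x ord0 i))).
  have d1 : is_derive (0 : R) 1 (fun h : R => S + (2 * h * x ord0 i + h ^+ 2)) (2 * x ord0 i).
    have -> : (fun h : R => S + (2 * h * x ord0 i + h ^+ 2)) =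
        cst S + ((2 * x ord0 i) *: id + id * id).
      by apply/funext => h; rewrite !fctE /GRing.scale/=; ring.
    have di := is_derive_id (0 : R) 1.
    apply: (is_derive_eq (is_deriveD (is_derive_cst S (0 : R) 1)
      (is_deriveD (is_deriveZ (2 * x ord0 i) di) (is_deriveM di di)))).
    by rewrite /GRing.scale/=; ring.
  have S00 : 0 < S + (2 * 0 * x ord0 i + 0 ^+ 2) by rewrite mulr0 mul0r expr0n !addr0.
  have d2 := @is_derive1_comp _ (fun a => a `^ (p / 2))
    (fun h : R => S + (2 * h * x ord0 i + h ^+ 2)) 0 _ _ (is_derive1_powR _ S00) d1.
  apply: (is_derive_eq (is_deriveZ c d2)).
  by rewrite mulr0 mul0r expr0n !addr0.
have e : c * (p / 2 * S `^ (p / 2 - 1) * (2 * x ord0 i)) =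
    c * p * enorm x `^ (p - 2) * x ord0 i.
  rewrite powR_enorm -/S (_ : (p - 2) / 2 = p / 2 - 1); last by field.
  by field.
rewrite -e; split.
  by apply/derivable1P; rewrite -/f fphi; have [] := dphi.
rewrite -(@derive_val _ _ _ _ _ _ _ dphi) /derive.
(* The two derivatives are limits of the same difference quotient. *)
suff -> : (fun h : R => h^-1 *: ((f \o shift x) (h *: delta_mx ord0 i) - f x)) =
  (fun h : R => h^-1 *: ((phi \o shift 0) (h *: 1) - phi 0)) by [].
by apply/funext => h /=; rewrite -fphi /= addr0 scale0r add0r /GRing.scale/= mulr1.
Qed.

Lemma grad_powR_enorm (c p : R) x : x != 0 ->
  grad (fun y => c * enorm y `^ p) x = (c * p * enorm x `^ (p - 2)) *: x.
Proof.
move=> x0; apply/rowP => i; rewrite !mxE.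
exact: (@derive_val _ _ _ _ _ _ _ (is_derive_powR_enorm c p i x0)).
Qed.

End euclidean_norm.

(** * Volumes of balls *)

Section Wallis.
Context {R : realType}.
Notation mu := (@lebesgue_measure R).
Implicit Types r t : R.

(** The integral of [(1 - t^2)^(m/2)] over [[-1, 1]]. *)
Fixpoint wallis (m : nat) : R :=
  match m with
  | 0%N => 2
  | 1%N => pi / 2
  | k.+2 => k.+2%:R / k.+3%:R * wallis k
  end.

Let q r t : R := Num.sqrt (r ^+ 2 - t ^+ 2).

Let continuous_q r : continuous (q r).
Proof.
move=> t; apply: (@continuous_comp _ _ _ (fun t : R => r ^+ 2 - t ^+ 2) Num.sqrt).
  by apply: cvgB; [exact: cvg_cst|exact: exprn_continuous].
exact: sqrt_continuous.
Qed.

Let continuous_qX r m : continuous (fun t : R => q r t ^+ m).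
Proof.
move=> t; apply: (@continuous_comp _ _ _ (q r) (fun x : R => x ^+ m)).
  exact: continuous_q.
exact: exprn_continuous.
Qed.

Let integrable_qX r m : mu.-integrable `[- r, r] (EFin \o (fun t => q r t ^+ m)).
Proof.
apply: continuous_compact_integrable; first exact: segment_compact.
by apply: continuous_subspaceT; exact: continuous_qX.
Qed.

Let q_gt0 r t : - r < t < r -> 0 < q r t.
Proof. by move=> /andP[? ?]; rewrite sqrtr_gt0; nra. Qed.

Let q_sqr r t : - r < t < r -> q r t ^+ 2 = r ^+ 2 - t ^+ 2.
Proof. by move=> /andP[? ?]; rewrite sqr_sqrtr//; nra. Qed.

Let q_end r : q r r = 0 /\ q r (- r) = 0.
Proof. by rewrite /q sqrrN subrr sqrtr0. Qed.

Let is_derive_sqr t : is_derive t 1 (fun x : R => x ^+ 2) (2 * t).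
Proof.
apply: (is_derive_eq (is_deriveM (is_derive_id t 1) (is_derive_id t 1))).
by rewrite /GRing.scale/= mulr1 mulr_natl.
Qed.

Let is_derive_q r t : - r < t < r -> is_derive t 1 (q r) (- t / q r t).
Proof.
move=> rtr; have q0 := q_gt0 rtr.
have d1 : is_derive t 1 (fun t : R => r ^+ 2 - t ^+ 2) (- (2 * t)).
  by apply: (is_derive_eq (is_deriveB (is_derive_cst (r ^+ 2) t 1) (is_derive_sqr t)));
    rewrite sub0r.
have p0 : 0 < r ^+ 2 - t ^+ 2 by rewrite -sqrtr_gt0.
apply: (is_derive_eq (@is_derive1_comp _ Num.sqrt _ t _ _ (is_derive1_sqrt p0) d1)).
by rewrite -/(q r t); field; rewrite gt_eqF.
Qed.

(** From exponent 2 on, the factor [1 / q] of [is_derive_q] cancels, and the derivative is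
    continuous up to the end points. *)
Let is_derive_qX r t k : - r < t < r ->
  is_derive t 1 (fun t => q r t ^+ k.+2) (- (k.+2%:R * t * q r t ^+ k)).
Proof.
move=> rtr; have := is_deriveX k.+2 (is_derive_q rtr).
rewrite (_ : q r ^+ k.+2 = fun t => q r t ^+ k.+2); last first.
  by apply/funext => x; rewrite fctE.
move=> d; apply: (is_derive_eq d); rewrite /GRing.scale/= exprS.
by field; rewrite gt_eqF// q_gt0.
Qed.

Let FTC_itv (f F : R -> R) r : 0 < r -> continuous f -> continuous F ->
  (forall t, - r < t < r -> is_derive t 1 F (f t)) ->
  \int[mu]_(t in `[- r, r]) f t = F r - F (- r).
Proof.
move=> r0 cf cF dF; rewrite /Rintegral.
rewrite (@continuous_FTC2 _ f F (- r) r)//.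
- by rewrite gtrN.
- exact: continuous_subspaceT.
- split.
  + by move=> x; rewrite in_itv/= => /dF[].
  + by apply: cvg_at_right_filter; exact: cF.
  + by apply: cvg_at_left_filter; exact: cF.
- by move=> x; rewrite in_itv/= => /dF ?; rewrite derive1E; exact: derive_val.
Qed.

(* Integrate the derivative of [t * q r t ^+ m.+2]. *)
Let Rint_rec r m : 0 < r ->
  m.+3%:R * \int[mu]_(t in `[- r, r]) (q r t ^+ m.+2) =
  m.+2%:R * r ^+ 2 * \int[mu]_(t in `[- r, r]) (q r t ^+ m).
Proof.
move=> r0; apply/eqP; rewrite -subr_eq0; apply/eqP.
rewrite -!RintegralZl// -RintegralB//; last 2 first.
- exact: (integrableZl _ m.+3%:R (integrable_qX r m.+2)).
- exact: (integrableZl _ (m.+2%:R * r ^+ 2) (integrable_qX r m)).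
transitivity (r * q r r ^+ m.+2 - - r * q r (- r) ^+ m.+2); last first.
  by have [-> ->] := q_end r; rewrite !expr0n/= !mulr0 subrr.
apply: (@FTC_itv _ (fun t => t * q r t ^+ m.+2)) => //.
- move=> x; apply: cvgB; apply: cvgM; try exact: cvg_cst; exact: continuous_qX.
- by move=> x; apply: cvgM; [exact: cvg_id|exact: continuous_qX].
- move=> t rtr.
  apply: (is_derive_eq (is_deriveM (is_derive_id t 1) (is_derive_qX m rtr))).
  rewrite /GRing.scale/= mulr1.
  have -> : q r t ^+ m.+2 = q r t ^+ m * (r ^+ 2 - t ^+ 2).
    by rewrite -(q_sqr rtr) -exprD addn2.
  by rewrite -!natr1; ring.
Qed.

Let Rint_1 r : 0 < r -> \int[mu]_(t in `[- r, r]) q r t = pi / 2 * r ^+ 2.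
Proof.
move=> r0.
have D0 t : 0 < r + q r t by rewrite ltr_pwDl// sqrtr_ge0.
pose u t := t / (r + q r t).
have cu : continuous u.
  move=> t; apply: cvgM; first exact: cvg_id.
  apply: cvgV; first by rewrite gt_eqF.
  by apply: cvgD; [exact: cvg_cst|exact: continuous_q].
(* [2 atan (u t)] is [asin (t / r)], in a form that is continuous on [-r, r]. *)
pose F t := t * q r t / 2 + r ^+ 2 * atan (u t).
transitivity (F r - F (- r)); last first.
  have [qr qNr] := q_end r.
  rewrite /F /u qr qNr !mulr0 mul0r !add0r addr0 mulNr divff ?gt_eqF//.
  by rewrite atanN atan1; field.
apply: FTC_itv => //.
- move=> x; apply: cvgD; apply: cvgM; try exact: cvg_cst.
    by apply: cvgM; [exact: cvg_id|exact: continuous_q].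
  by apply: (@continuous_comp _ _ _ u atan); [exact: cu|exact: continuous_atan].
- move=> t rtr; have q0 := q_gt0 rtr; have dq := is_derive_q rtr.
  have dD : is_derive t 1 (fun t => r + q r t) (- t / q r t).
    by apply: (is_derive_eq (is_deriveD (is_derive_cst r t 1) dq)); rewrite add0r.
  have dV : is_derive t 1 (fun t => (r + q r t)^-1)
      (- (r + q r t) ^- 2 *: (- t / q r t)).
    by apply: is_deriveV; rewrite gt_eqF.
  have du := is_deriveM (is_derive_id t 1) dV.
  have dA := @is_derive1_comp _ atan u t _ _ (is_derive1_atan _) du.
  have d1 := is_deriveM (is_deriveM (is_derive_id t 1) dq) (is_derive_cst (2^-1 : R) t 1).
  have d2 := is_deriveM (is_derive_cst (r ^+ 2 : R) t 1) dA.
  apply: (is_derive_eq (is_deriveD d1 d2)).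
  rewrite /GRing.scale/= /u !(add0r, addr0, mulr1, mulr0).
  have sE := q_sqr rtr; move: q0 sE (D0 t); set s := q r t => q0 sE D0t.
  have tE : t ^+ 2 = r ^+ 2 - s ^+ 2 by rewrite sE; ring.
  have -> : 1 + (t / (r + s)) ^+ 2 = 2 * r / (r + s).
    by rewrite expr_div_n tE; field; rewrite gt_eqF.
  have -> : t * (- (r + s) ^- 2 * (- t / s)) = t ^+ 2 * ((r + s) ^- 2 / s) by ring.
  have -> : t * (- t / s) = - t ^+ 2 / s by ring.
  by rewrite tE; field; rewrite !gt_eqF.
Qed.

Lemma integral_wallis r m : 0 <= r ->
  (\int[mu]_(t in `[(- r)%R, r]) (Num.sqrt (r ^+ 2 - t ^+ 2)%R ^+ m)%:E =
   (wallis m * r ^+ m.+1)%:E)%E.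
Proof.
rewrite le_eqVlt => /predU1P[<-|r0].
  by rewrite oppr0 set_itv1 integral_set1 expr0n/= mulr0.
suff <- : \int[mu]_(t in `[- r, r]) (q r t ^+ m) = wallis m * r ^+ m.+1.
  rewrite /Rintegral fineK//; apply: integrable_fin_num => //; exact: integrable_qX.
have [k] := ubnP m; elim: k m => // k IH [|[|m]] mk.
- rewrite (_ : (fun t => _) = cst 1) ?Rintegral_cst//.
  have E : mu `[- r, r]%classic = (2 * r)%:E.
    rewrite lebesgue_measure_itv/= lte_fin gtrN// -EFinB.
    by congr EFin; rewrite opprK mulr2n mulrDl mul1r.
  by rewrite mul1r expr1; exact: (congr1 fine E).
- exact: Rint_1.
- have := Rint_rec m r0; rewrite (IH m (ltn_trans (ltnSn m) mk)).
  move=> H; apply: (@mulfI _ m.+3%:R); first by rewrite pnatr_eq0.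
  rewrite H [wallis m.+2]/= -/(wallis m) [r ^+ m.+3](exprD r 2 m.+1).
  have a0 : m.+3%:R != 0 :> R by rewrite pnatr_eq0.
  by move: m.+3%:R m.+2%:R a0 => a b a0; field.
Qed.

(** The product of two consecutive factors has a closed form free of parity, and it is all that
    raising the dimension by two requires. *)
Lemma wallisM m : wallis m * wallis m.+1 = 2 * pi / m.+2%:R.
Proof.
elim: m => [|m IH]; first by rewrite /=; field.
rewrite [wallis m.+2]/= -/(wallis m) mulrCA (mulrC (wallis m.+1)) IH.
have a0 : m.+3%:R != 0 :> R by rewrite pnatr_eq0.
have b0 : m.+2%:R != 0 :> R by rewrite pnatr_eq0.
by move: m.+3%:R m.+2%:R a0 b0 => a b a0 b0; field; apply/andP.
Qed.

End Wallis.

Section ball_volume.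
Context {R : realType}.
Notation mu := (@lebesgue_measure R).

(* [rho] is the square of the radius. *)
Definition cball m (rho : R) : set 'rV[R]_m :=
  [set v | \sum_(i < m) v ord0 i ^+ 2 <= rho].

(** The cone over the sphere lacks its apex, because [cone_over] asks for [0 < r]; hence the
    punctured balls. *)
Definition pball m (rho : R) : set 'rV[R]_m := cball rho `\ 0.

(** Volume of the unit ball: its slice at height [t] is a ball of radius [sqrt (1 - t^2)], and
    integrating the volumes of the slices yields the factor [wallis k]. *)
Fixpoint ball_volume (m : nat) : R :=
  if m is k.+1 then ball_volume k * wallis k else 1.

Lemma lebesgue_rV_set0 m : lebesgue_rV (set0 : set 'rV[R]_m) = 0%E.
Proof.
elim: m => [|m IH] /=; first by rewrite indic0.
rewrite -[RHS](@integral0 _ _ _ mu setT); apply: eq_integral => t _.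
by rewrite -[RHS]IH; congr lebesgue_rV.
Qed.

Lemma lebesgue_rVS m (A : set 'rV[R]_m.+1) : (lebesgue_rV A =
  \int[mu]_(t in [set: R])
    lebesgue_rV [set v : 'rV[R]_m | A (row_mx (t%:M : 'rV[R]_1) v)])%E.
Proof. by []. Qed.

Lemma sum_sqr_row_mx m (t : R) (v : 'rV[R]_m) :
  \sum_(i < 1 + m) row_mx (t%:M : 'rV[R]_1) v ord0 i ^+ 2 =
  t ^+ 2 + \sum_(i < m) v ord0 i ^+ 2.
Proof.
rewrite big_split_ord/= big_ord1 row_mxEl mxE eqxx mulr1n; congr (_ + _).
by apply: eq_bigr => i _; rewrite row_mxEr.
Qed.

Lemma cball_slice m (rho t : R) :
  [set v : 'rV[R]_m | @cball m.+1 rho (row_mx (t%:M : 'rV[R]_1) v)] =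
  cball (rho - t ^+ 2).
Proof.
by apply/seteqP; split=> v; rewrite /cball/= sum_sqr_row_mx lerBrDl.
Qed.

Lemma pball_slice m (rho t : R) :
  [set v : 'rV[R]_m | @pball m.+1 rho (row_mx (t%:M : 'rV[R]_1) v)] =
  if t == 0 then pball rho else cball (rho - t ^+ 2).
Proof.
have E (v : 'rV[R]_m) : row_mx (t%:M : 'rV[R]_1) v = 0 <-> t = 0 /\ v = 0.
  split=> [|[-> ->]].
    rewrite -[0](@row_mx0 R 1 1 m) => /eq_row_mx[t0 ->]; split => //.
    by move/matrixP : t0 => /(_ ord0 ord0); rewrite !mxE eqxx mulr1n.
  by rewrite -[RHS](@row_mx0 R 1 1 m); congr row_mx; apply/matrixP => i j;
    rewrite !mxE mul0rn.
have {}E (v : 'rV[R]_m) : @pball m.+1 rho (row_mx (t%:M : 'rV[R]_1) v) <->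
    cball (rho - t ^+ 2) v /\ ~ (t = 0 /\ v = 0).
  by rewrite -cball_slice /pball; split=> -[? H]; split => // /E.
case: eqP => [t0|t0].
  apply/seteqP; split=> v.
    by move=> /E; rewrite t0 expr0n subr0 => -[? H]; split => // v0; apply: H.
  by move=> [? H]; apply/E; rewrite t0 expr0n subr0; split=> // -[].
by apply/seteqP; split=> v; [move=> /E[]|move=> ?; apply/E; split => // -[]].
Qed.

Let sqr_le (rho t : R) : 0 <= rho ->
  (t ^+ 2 <= rho) = (- Num.sqrt rho <= t <= Num.sqrt rho).
Proof.
move=> r0; rewrite -ler_norml -[in LHS](sqr_sqrtr r0) -[in LHS]real_normK ?num_real//.
by rewrite ler_sqr// nnegrE sqrtr_ge0.
Qed.

Lemma cball_lt0 m (rho : R) : rho < 0 -> @cball m rho = set0.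
Proof.
move=> r0; apply/seteqP; split=> // v; rewrite /cball/= => H.
by have := le_trans (sum_sqr_ge0 v) H; rewrite leNgt r0.
Qed.

(** Shared by full and punctured balls; [h t] stands for the volume of the slice at height [t] and
    [v] for that of the unit ball of dimension [m]. *)
Let integral_slices m (v : R) (h : R -> \bar R) (rho : R) : 0 <= rho ->
  (forall t, t ^+ 2 <= rho -> h t = (v * Num.sqrt (rho - t ^+ 2) ^+ m)%:E) ->
  (forall t, rho < t ^+ 2 -> h t = 0%E) ->
  (\int[mu]_(t in [set: R]) h t = (v * wallis m * Num.sqrt rho ^+ m.+1)%:E)%E.
Proof.
move=> r0 h1 h2; pose r := Num.sqrt rho.
transitivity (\int[mu]_(t in `[(- r)%R, r])
    (v%:E * (Num.sqrt (r ^+ 2 - t ^+ 2) ^+ m)%:E))%E.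
  rewrite [RHS]integral_mkcond; apply: eq_integral => t _.
  rewrite patchE; case: ifPn.
    rewrite inE/= in_itv/= -sqr_le// => tr.
    by rewrite h1// -EFinM /r sqr_sqrtr.
  rewrite notin_setE/= in_itv/= -sqr_le// => /negP; rewrite -ltNge => tr.
  by rewrite h2.
rewrite integralZl//; last first.
  apply: continuous_compact_integrable; first exact: segment_compact.
  apply: continuous_subspaceT => t.
  apply: (@continuous_comp _ _ _ (fun t : R => Num.sqrt (r ^+ 2 - t ^+ 2)) (fun x : R => x ^+ m)).
    apply: (@continuous_comp _ _ _ (fun t : R => r ^+ 2 - t ^+ 2) Num.sqrt).
      by apply: cvgB; [exact: cvg_cst|exact: exprn_continuous].
    exact: sqrt_continuous.
  exact: exprn_continuous.
by rewrite integral_wallis ?sqrtr_ge0// -EFinM mulrA.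
Qed.

Lemma lebesgue_cball m (rho : R) : 0 <= rho ->
  lebesgue_rV (@cball m rho) = (ball_volume m * Num.sqrt rho ^+ m)%:E.
Proof.
elim: m rho => [|m IH] rho r0 /=.
  by rewrite expr0 mulr1 indicE mem_set// /cball/= big_ord0.
apply: (@integral_slices m) => // t tr.
  by rewrite cball_slice IH// subr_ge0.
by rewrite cball_slice cball_lt0 ?lebesgue_rV_set0// subr_lt0.
Qed.

Lemma lebesgue_pball m (rho : R) : 0 <= rho ->
  lebesgue_rV (@pball m.+1 rho) = (ball_volume m.+1 * Num.sqrt rho ^+ m.+1)%:E.
Proof.
elim: m rho => [|m IH] rho r0.
  (* In dimension 0, removing the origin leaves nothing, so the slice at [t = 0] has volume 0
     instead of 1. This single height is negligible in the outer integral. In higher dimensions the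
     punctured slice has full volume by induction. *)
  pose r := Num.sqrt rho.
  transitivity (\int[mu]_(t in `[(- r)%R, r] `\ 0%R)
      (Num.sqrt (r ^+ 2 - t ^+ 2) ^+ 0)%:E)%E.
    rewrite lebesgue_rVS [RHS]integral_mkcond; apply: eq_integral => t _.
    rewrite pball_slice patchE; case: eqP => [->|t0].
      rewrite memNset//; last by move=> [_]; apply.
      by rewrite /= indicE memNset//= => -[_]; apply.
    case: ifPn => [/set_mem[/= tr _]|/negP tr].
      move: tr; rewrite in_itv/= -sqr_le// => tr.
      rewrite -subr_ge0 in tr.
      by apply: etrans (@lebesgue_cball 0 _ tr) _; rewrite mul1r !expr0.
    rewrite cball_lt0 ?lebesgue_rV_set0// subr_lt0 ltNge; apply/negP => tr'.
    by apply: tr; apply/mem_set; split => //=; rewrite in_itv/= -sqr_le.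
  rewrite integral_setD1.
  - by rewrite integral_wallis ?sqrtr_ge0//= mul1r.
  - by apply: measurableD => //; exact: measurable_itv.
  - exact: (@measurable_cst _ _ _ _ _ (1%:E)%E).
rewrite lebesgue_rVS.
apply: (@integral_slices m.+1) => // t tr.
  rewrite pball_slice; case: ifPn => [/eqP ->|_].
    by rewrite IH// expr0n subr0.
  by rewrite lebesgue_cball// subr_ge0.
rewrite pball_slice ifF; first by rewrite cball_lt0 ?lebesgue_rV_set0// subr_lt0.
by apply/eqP => t0; move: tr; rewrite t0 expr0n/= ltNge r0.
Qed.

Lemma cone_over_sphere m :
  cone_over [set u : 'rV[R]_m | enorm u = 1] = pball 1.
Proof.
have cballE (u : 'rV[R]_m) : cball 1 u <-> enorm u <= 1.
  by rewrite /cball/= /enorm -{2}(@sqrtr1 R) ler_sqrt ?sum_sqr_ge0.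
apply/seteqP; split=> x.
  move=> [r [u [/andP[r0 r1] u1 ->]]]; split.
    by apply/cballE; rewrite enormZ u1 mulr1 gtr0_norm.
  move=> ru0; have := enormZ r u; rewrite ru0 u1 mulr1 gtr0_norm//.
  by move=> r0'; move: r0; rewrite -r0' enorm_gt0 eqxx.
move=> [/cballE x1 x0].
have e0 : 0 < enorm x by rewrite enorm_gt0; apply/eqP.
exists (enorm x), ((enorm x)^-1 *: x); split.
- by rewrite e0.
- by rewrite /= enormZ gtr0_norm ?invr_gt0// mulVf// gt_eqF.
- by rewrite scalerA divff ?scale1r// gt_eqF.
Qed.

Lemma sphere_areaE m : @sphere_area R m.+1 = m.+1%:R * ball_volume m.+1.
Proof.
rewrite /sphere_area /surface_measure cone_over_sphere lebesgue_pball//.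
by rewrite sqrtr1 expr1n mulr1.
Qed.

(** Two dimensions at a time: [wallisM] contributes [2 pi / (m + 2)], which is [pi] divided by the
    factor [m / 2 + 1] that [GammaS] produces. *)
Lemma ball_volumeE m : ball_volume m * Gamma (m%:R / 2 + 1) = pi `^ (m%:R / 2).
Proof.
have pi0 : 0 < pi :> R := pi_gt0 R.
have [k] := ubnP m; elim: k m => // k IH [|[|m]] mk.
- by rewrite mul0r add0r Gamma1 mulr1 powRr0.
- rewrite /= (_ : 1 / 2 + 1 = 3 / 2 :> R); last by field.
  rewrite Gamma_3half mul1r (_ : 1 / 2 = 2^-1 :> R) ?mul1r// powR12_sqrt ?(ltW pi0)//.
  by field.
- have m0 : 0 < m%:R / 2 + 1 :> R by rewrite ltr_wpDl// divr_ge0.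
  have -> : ball_volume m.+2 = ball_volume m * (wallis m * wallis m.+1).
    by rewrite mulrA.
  rewrite wallisM.
  have e : m.+2%:R / 2 = m%:R / 2 + 1 :> R.
    by rewrite -addn2 natrD mulrDl divff.
  rewrite e GammaS// powRD; last by rewrite (gt_eqF pi0) implybT.
  rewrite powRr1 ?(ltW pi0)// -(IH m (ltn_trans (ltnSn m) _))//.
  have -> : m.+2%:R = 2 * (m%:R / 2 + 1) :> R by rewrite -e mulrC divfK.
  by move: (m%:R / 2 + 1) m0 => a m0; field; rewrite gt_eqF.
Qed.

Lemma ball_volume_gt0 m : 0 < ball_volume m.
Proof.
suff H : 0 < wallis 0 :> R /\ 0 < wallis 1 :> R.
  have w k : 0 < wallis k :> R.
    have [j] := ubnP k; elim: j k => // j IH [|[|k]] kj; [exact: H.1|exact: H.2|].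
    by rewrite /= mulr_gt0 ?divr_gt0// (IH k (ltn_trans (ltnSn k) _)).
  by elim: m => //= m IH; rewrite mulr_gt0.
by split => //=; rewrite divr_gt0// pi_gt0.
Qed.

Lemma Phi1E m : (2 < m)%N -> @Phi1 R m = Phi 1.
Proof.
case: m => // m m2; apply/funext => x; rewrite /Phi1 /Phi mulr1; congr (_ * _).
have pi0 : 0 < pi :> R := pi_gt0 R.
rewrite sphere_areaE /kappa Gamma1 mulr1.
have := ball_volumeE m.+1; have := ball_volume_gt0 m.+1.
set v := ball_volume _; set a := m.+1%:R => v0.
have a2 : 2 < a by rewrite /a ltr_nat.
rewrite GammaS ?divr_gt0 ?(lt_trans _ a2)//.
have -> : a / 2 = (a - 2) / 2 + 1 by field.
rewrite GammaS ?divr_gt0 ?subr_gt0// => H.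
(* The volume formula itself excludes a zero of Gamma here, its right-hand side being a power of
   [pi]. *)
have G0 : Gamma ((a - 2) / 2) != 0.
  apply/eqP => G0; move: H; rewrite G0 !mulr0 => /eqP.
  by rewrite eq_sym gt_eqF// powR_gt0.
rewrite -H; move: (Gamma _) G0 => G G0.
rewrite mulr1 (_ : 2 `^ 2 = 4); last first.
  by rewrite powR_mulrn// expr2; ring.
by field; rewrite G0 !gt_eqF// ?subr_gt0//; lra.
Qed.


End ball_volume.

(** * Limits of the kernels *)

Section kernel_limits.
Context {R : realType}.

Lemma grad_Phi n (s : R) (x : 'rV[R]_n) : x != 0 ->
  grad (Phi s) x = (kappa n s * (2 * s - n%:R) * enorm x `^ (2 * s - n%:R - 2)) *: x.
Proof. exact: grad_powR_enorm. Qed.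

Lemma continuous_powR_exponent (a s : R) : 0 < a -> {for s, continuous (fun x : R => a `^ x)}.
Proof.
move=> a0; rewrite (_ : (fun x => _) = (fun x => expR (x * ln a))); last first.
  by apply/funext => x; rewrite /powR gt_eqF.
apply: (@continuous_comp _ _ _ (fun x : R => x * ln a) expR); last exact: continuous_expR.
by apply: continuousM => //; exact: cst_continuous.
Qed.

Lemma cvg_kappa n : (2 < n)%N -> kappa n s @[s --> (1 : R)] --> kappa n 1.
Proof.
move=> n2; have pi0 := pi_gt0 R.
have c2 : 2 * s @[s --> (1 : R)] --> (2 * 1 : R) by apply: cvgM => //; exact: cvg_cst.
have n0 : 0 < (n%:R - 2 * 1) / 2 :> R by rewrite divr_gt0// mulr1 subr_gt0 ltr_nat.
apply: cvgM.
  apply: continuous_cvg; first exact: continuous_Gamma.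
  by apply: cvgM; [apply: cvgB => //; exact: cvg_cst|exact: cvg_cst].
apply: cvgV; first by rewrite Gamma1 mulr1 mulf_neq0// gt_eqF// powR_gt0.
apply: cvgM; last by apply: continuous_Gamma.
apply: cvgM; last exact: cvg_cst.
by apply: continuous_cvg => //; exact: continuous_powR_exponent.
Qed.

Let left_of (l : R) : (fun s : R => s) @ l^'- --> l.
Proof. by apply: cvg_at_left_filter; exact: cvg_id. Qed.

Section joint.
Variables (T : topologicalType) (y : T) (F : set_system R).
Context {FF : Filter F}.

Lemma joint_snd (U : topologicalType) (f : R -> U) (l : U) :
  f @ F --> l -> f z.2 @[z --> filter_prod (nbhs y) F] --> l.
Proof. by move=> fl; apply: (cvg_comp _ _ _ fl); exact: cvg_snd. Qed.

Lemma joint_fst (U : topologicalType) (f : T -> U) :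
  {for y, continuous f} -> f z.1 @[z --> filter_prod (nbhs y) F] --> f y.
Proof. by move=> cf; apply: (@cvg_comp _ _ _ fst f _ (nbhs y) _ cvg_fst cf). Qed.

End joint.

Lemma joint_enorm_powR n (y : 'rV[R]_n) (F : set_system R) (p : R -> R) (l : R) :
  Filter F -> y != 0 -> p @ F --> l ->
  enorm z.1 `^ p z.2 @[z --> filter_prod (nbhs y) F] --> enorm y `^ l.
Proof.
move=> FF y0 pl; apply: cvg_powR_joint.
- by rewrite enorm_gt0.
- by apply: joint_fst; exact: continuous_enorm.
- exact: joint_snd.
Qed.

Lemma near_neq0 n (y : 'rV[R]_n) : y != 0 -> \forall z \near y, z != 0.
Proof.
move=> y0; have e0 : 0 < enorm y by rewrite enorm_gt0.
have := continuous_enorm (x := y) => /cvgr_gt/(_ _ e0).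
by apply: filterS => z; rewrite enorm_gt0.
Qed.

Lemma continuous_cst_powR_enorm n (c p : R) (y : 'rV[R]_n) : y != 0 ->
  {for y, continuous (fun x => c * enorm x `^ p)}.
Proof.
move=> y0; apply: continuousM; first exact: cst_continuous.
apply: (@continuous_comp _ _ _ (@enorm R n) (fun a => a `^ p)).
  exact: continuous_enorm.
by apply: continuous_powR; rewrite enorm_gt0.
Qed.

Lemma continuous_grad_Phi n (s : R) (y : 'rV[R]_n) : y != 0 ->
  {for y, continuous (grad (@Phi R n s))}.
Proof.
move=> y0.
apply: (@cvg_trans _ (((kappa n s * (2 * s - n%:R)) *
    enorm x `^ (2 * s - n%:R - 2)) *: x @[x --> y])).
  apply: (@near_eq_cvg _ _ (nbhs y)); near=> x; rewrite grad_Phi//.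
  by near: x; exact: near_neq0.
rewrite grad_Phi//.
apply: (@cvgZ _ 'rV[R]_n _ (nbhs y) _
  (fun x => kappa n s * (2 * s - n%:R) * enorm x `^ (2 * s - n%:R - 2)) id).
  exact: continuous_cst_powR_enorm.
exact: cvg_id.
Unshelve. all: by end_near. Qed.

(** Only the product of [kappa n s] and [2 * s - n] has to converge: in the plane the pole of
    [kappa 2 s] is cancelled by [2 * s - 2]. *)
Lemma cvg_grad_Phi n (c p : R) :
  kappa n s * (2 * s - n%:R) @[s --> 1^'-] --> c ->
  (2 * 1 - n%:R - 2 = p :> R) ->
  {family compactly_in (~` [set (0 : 'rV[R]_n)]),
    (fun s => grad (@Phi R n s)) @ 1^'- --> (fun x => (c * enorm x `^ p) *: x)}.
Proof.
move=> cc pE; apply: joint_cvg_compactly_in => y /eqP y0.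
  apply: (@cvgZ _ 'rV[R]_n _ (nbhs y) _ (fun x => c * enorm x `^ p) id).
    exact: continuous_cst_powR_enorm.
  exact: cvg_id.
apply: (@cvg_trans _ (((kappa n z.2 * (2 * z.2 - n%:R)) *
    enorm z.1 `^ (2 * z.2 - n%:R - 2)) *: z.1 @[z --> filter_prod (nbhs y) (1 : R)^'-])).
  apply: (@near_eq_cvg _ _ (filter_prod (nbhs y) (1 : R)^'-)); near=> z; rewrite grad_Phi//; near: z.
  exact: (cvg_fst (near_neq0 y0)).
apply: (@cvgZ _ 'rV[R]_n _ (filter_prod (nbhs y) (1 : R)^'-) _
  (fun z => kappa n z.2 * (2 * z.2 - n%:R) * enorm z.1 `^ (2 * z.2 - n%:R - 2)) fst);
  last exact: cvg_fst.
apply: cvgM; first exact: (joint_snd _ cc).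
apply: (@joint_enorm_powR _ _ _ (fun s => 2 * s - n%:R - 2)) => //; rewrite -pE.
apply: cvgB; last exact: cvg_cst.
apply: cvgB; last exact: cvg_cst.
by apply: cvgM; [exact: cvg_cst|exact: left_of].
Unshelve. all: by end_near. Qed.

Lemma cvg_Phi n : (2 < n)%N ->
  {family compactly_in (~` [set (0 : 'rV[R]_n)]),
    (fun s => @Phi R n s) @ 1^'- --> @Phi R n 1}.
Proof.
move=> n2; apply: joint_cvg_compactly_in => y /eqP y0.
  exact: continuous_cst_powR_enorm.
apply: cvgM.
  by apply: (@joint_snd _ _ _ _ (kappa n)); apply: cvg_at_left_filter; exact: cvg_kappa.
apply: (@joint_enorm_powR _ _ _ (fun s => 2 * s - n%:R)) => //.
apply: cvgB; last exact: cvg_cst.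
by apply: cvgM; [exact: cvg_cst|exact: left_of].
Qed.

Lemma cvg_grad_Phi_ge3 n : (2 < n)%N ->
  {family compactly_in (~` [set (0 : 'rV[R]_n)]),
    (fun s => grad (@Phi R n s)) @ 1^'- --> grad (@Phi R n 1)}.
Proof.
move=> n2.
apply/compactly_in_cvgP => K K0 cK e e0.
have H : kappa n s * (2 * s - n%:R) @[s --> 1^'-] --> kappa n 1 * (2 * 1 - n%:R : R).
  apply: cvgM; first by apply: cvg_at_left_filter; exact: cvg_kappa.
  apply: cvgB; last exact: cvg_cst.
  by apply: cvgM; [exact: cvg_cst|exact: left_of].
have /compactly_in_cvgP/(_ K K0 cK e e0) := @cvg_grad_Phi n _ _ H erefl.
by apply: filterS => s Hs y Ky; rewrite grad_Phi; [exact: Hs|apply/eqP; exact: K0].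
Qed.

(** * The plane: cancelling the pole of the kernel *)

Section planar.

(* [A], that is, [kappa 2] without its pole at [s = 1]. *)
Let planar_factor (s : R) : R := Gamma (2 - s) / (2 `^ (2 * s) * pi * Gamma s).

(** The pole sits in [Gamma (1 - s)], which [GammaS] turns into [Gamma (2 - s) / (1 - s)]. *)
Let kappa2E s : s < 1 -> kappa 2 s = planar_factor s / (1 - s).
Proof.
move=> s1; have s0 : 0 < 1 - s by rewrite subr_gt0.
rewrite /kappa /planar_factor divff// powRr1 ?(ltW (pi_gt0 R))//.
have -> : (2 - 2 * s) / 2 = 1 - s by field.
have -> : 2 - s = (1 - s) + 1 by ring.
rewrite GammaS//; move: (_ * Gamma s)^-1 (Gamma (1 - s)) => D G.
by field; rewrite gt_eqF.
Qed.

Let planar_factor1 : planar_factor 1 = 1 / (4 * pi).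
Proof.
rewrite /planar_factor (_ : 2 - 1 = 1 :> R); last by ring.
rewrite Gamma1 !mulr1 powR_mulrn// expr2; congr (_ / (_ * _)); ring.
Qed.

Let derivable_planar_factor : derivable planar_factor 1 1.
Proof.
have dG : is_derive (1 : R) 1 (@Gamma R) ('D_1 (@Gamma R) 1).
  by apply: derivableP; exact: derivable_Gamma.
have d1 : is_derive (1 : R) 1 (fun s : R => 2 - s) (0 - 1).
  exact: (is_deriveB (is_derive_cst (2 : R) (1 : R) 1) (is_derive_id (1 : R) 1)).
have dG' : is_derive (2 - 1 : R) 1 (@Gamma R) ('D_1 (@Gamma R) 1).
  by rewrite (_ : 2 - 1 = 1 :> R)//; ring.
have dG2 := @is_derive1_comp _ (@Gamma R) (fun s : R => 2 - s) 1 _ _ dG' d1.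
have d2 := @is_derive1_comp _ expR (fun s : R => (2 * ln 2) * s) 1 _ _
  (is_derive_expR _) (is_deriveZ (2 * ln 2) (is_derive_id (1 : R) 1)).
have d3 := is_deriveM (is_deriveM d2 (is_derive_cst (pi : R) (1 : R) 1)) dG.
have pE : (expR \o (fun s : R => (2 * ln 2) * s)) * cst pi * @Gamma R =
    (fun s : R => 2 `^ (2 * s) * pi * Gamma s).
  apply/funext => s; rewrite !fctE /powR gt_eqF//=; congr (expR _ * _ * _).
  exact: mulrAC.
rewrite {}pE in d3.
have n0 : 2 `^ (2 * 1) * pi * Gamma 1 != 0 :> R.
  by rewrite Gamma1 mulr1 mulf_neq0// gt_eqF// ?powR_gt0// pi_gt0.
pose D (s : R) := 2 `^ (2 * s) * pi * Gamma s.
have dD : derivable D 1 1 by have [] := d3.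
have dV : derivable (fun s => (D s)^-1) 1 1 by apply: derivableV.
have dN : derivable (@Gamma R \o (fun s : R => 2 - s)) 1 1 by have [] := dG2.
exact: (derivableM dN dV).
Qed.

Let cvg_planar_factor : planar_factor s @[s --> 1^'-] --> planar_factor 1.
Proof.
apply: cvg_at_left_filter.
exact: (differentiable_continuous (proj1 (derivable1_diffP _ _) derivable_planar_factor)).
Qed.

Let cvg_slope_left (f : R -> R) (a : R) : derivable f a 1 ->
  (f s - f a) / (s - a) @[s --> a^'-] --> 'D_1 f a.
Proof.
move=> df; apply/cvg_at_leftP => u [ua cu].
have /cvgr_dnbhsP H : h^-1 *: ((f \o shift a) (h *: (1 : R)) - f a) @[h --> 0^'] --> 'D_1 f a.
  exact: df.
rewrite (_ : (fun n => _) =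
    fun n => (u n - a)^-1 *: ((f \o shift a) ((u n - a) *: (1 : R)) - f a)); last first.
  by apply/funext => n; rewrite /= /GRing.scale/= mulr1 subrK mulrC.
apply: (H (fun n => u n - a)); split => [k|]; first by rewrite subr_eq0 lt_eqF.
by rewrite -[X in _ --> X](subrr a); apply: cvgB => //; exact: cvg_cst.
Qed.

(** The removable singularity is filled because the argument used in [cvg_Phi2] vanishes on the
    whole unit circle, not only in the limit. *)
Let expR_quotient (u : R) : R := if u == 0 then 1 else (expR u - 1) / u.

Let mulr_expR_quotient u : u * expR_quotient u = expR u - 1.
Proof.
rewrite /expR_quotient; case: eqP => [->|/eqP u0]; first by rewrite mul0r expR0 subrr.
by rewrite mulrC divfK.
Qed.

Let continuous_expR_quotient : {for 0, continuous expR_quotient}.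
Proof.
apply/cvgrPdist_lt => e e0.
have : h^-1 *: ((expR \o shift 0) (h *: (1 : R)) - expR 0) @[h --> 0^'] --> (1 : R).
  rewrite -[X in _ --> X](@expR0 R) -[X in _ --> X](@derive_val _ _ _ _ _ _ _ (is_derive_expR (0 : R))).
  exact: derivable_expR.
rewrite expR0 => /cvgrPdist_lt/(_ _ e0); rewrite near_withinE.
apply: filterS => u Hu; rewrite /expR_quotient eqxx.
case: eqP => [_|/eqP u0]; first by rewrite subrr normr0.
by have := Hu u0; rewrite /= addr0 /GRing.scale/= mulr1 mulrC.
Qed.

Let continuous_ln_enorm (a b : R) (y : 'rV[R]_2) : 0 < enorm y ->
  {for y, continuous (fun x => a * ln (enorm x) + b)}.
Proof.
move=> y0; apply: continuousD; last exact: cst_continuous.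
apply: continuousM; first exact: cst_continuous.
apply: (@continuous_comp _ _ _ (@enorm R 2) (@ln R)); first exact: continuous_enorm.
exact: continuous_ln.
Qed.

Lemma cvg_Phi2 : exists c0 : R,
  {family compactly_in (~` [set (0 : 'rV[R]_2)]),
    (fun (s : R) (x : 'rV[R]_2) => Phi s x - 1 / (4 * pi * (1 - s))) @ 1^'- -->
    (fun x : 'rV[R]_2 => - (1 / (2 * pi)) * ln (enorm x) + c0)}.
Proof.
exists (- 'D_1 planar_factor 1).
apply: joint_cvg_compactly_in => y /eqP y0; have ey0 : 0 < enorm y by rewrite enorm_gt0.
  exact: continuous_ln_enorm.
pose F2 := filter_prod (nbhs y) (1 : R)^'-.
pose u (z : 'rV[R]_2 * R) := - 2 * (1 - z.2) * ln (enorm z.1).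
(* [g] is the renormalized kernel for [s < 1], with both quotients by [1 - s] made explicit:
   [(|x|^(2s-2) - 1) / (1 - s)] as a multiple of [expR_quotient], and the slope of [planar_factor]
   at 1. *)
pose g (z : 'rV[R]_2 * R) := planar_factor z.2 * (- 2 * ln (enorm z.1) * expR_quotient (u z))
  - (planar_factor z.2 - planar_factor 1) / (z.2 - 1).
have cln : ln (enorm z.1) @[z --> F2] --> ln (enorm y).
  apply: continuous_cvg; first exact: continuous_ln.
  by apply: joint_fst; exact: continuous_enorm.
have c1s : 1 - z.2 @[z --> F2] --> (0 : R).
  rewrite -[X in _ --> X](subrr (1 : R)); apply: cvgB; first exact: cvg_cst.
  by apply: (@joint_snd _ _ _ _ id); exact: left_of.
apply: (@cvg_trans _ (g @ F2)).
  apply: (@near_eq_cvg _ _ F2); near=> z.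
  have z1 : z.1 != 0 by near: z; exact: (cvg_fst (near_neq0 y0)).
  have z2 : z.2 < 1.
    near: z; have H : \forall s \near (1 : R)^'-, s < 1 by exact: nbhs_left_lt.
    exact: (cvg_snd H).
  have s0 : 1 - z.2 != 0 by rewrite subr_eq0 gt_eqF.
  have s0' : z.2 - 1 != 0 by rewrite subr_eq0 lt_eqF.
  have e0 : enorm z.1 != 0 by rewrite enorm_eq0.
  have uE : expR (u z) = enorm z.1 `^ (2 * z.2 - 2).
    by rewrite /powR (negbTE e0) /u; congr expR; ring.
  have Q : - 2 * ln (enorm z.1) * expR_quotient (u z) =
      (enorm z.1 `^ (2 * z.2 - 2) - 1) / (1 - z.2).
    rewrite -uE -mulr_expR_quotient /u; move: (expR_quotient _) => q.
    by move: (ln _) s0 => L s0; field.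
  rewrite /g Q /Phi kappa2E// planar_factor1.
  move: (planar_factor _) (_ `^ _) => A p; move: z.2 s0 s0' => s s0 s0'.
  have p0 := lt0r_neq0 (pi_gt0 R).
  by move: pi p0 => P p0; field; rewrite s0 s0' p0.
have -> : - (1 / (2 * pi)) * ln (enorm y) + - 'D_1 planar_factor 1 =
  planar_factor 1 * (- 2 * ln (enorm y) * 1) - 'D_1 planar_factor 1.
  by rewrite planar_factor1; move: pi (lt0r_neq0 (pi_gt0 R)) => P p0; field.
apply: cvgB.
  apply: cvgM; first exact: joint_snd cvg_planar_factor.
  apply: cvgM; first by apply: cvgM => //; exact: cvg_cst.
  have -> : 1 = expR_quotient 0 by rewrite /expR_quotient eqxx.
  apply: continuous_cvg; first exact: continuous_expR_quotient.
  rewrite -[X in _ --> X](mul0r (ln (enorm y))); apply: cvgM => //.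
  by rewrite -[X in _ --> X](mulr0 (- 2)); apply: cvgM => //; exact: cvg_cst.
apply: (@joint_snd _ _ _ _ (fun s => (planar_factor s - planar_factor 1) / (s - 1))).
exact: cvg_slope_left.
Unshelve. all: by end_near. Qed.

Lemma cvg_grad_Phi2 :
  {family compactly_in (~` [set (0 : 'rV[R]_2)]),
    (fun s : R => grad (@Phi R 2 s)) @ 1^'- -->
    (fun x : 'rV[R]_2 => (- (1 / (2 * pi))) *: ((enorm x ^+ 2)^-1 *: x))}.
Proof.
rewrite (_ : (fun x : 'rV[R]_2 => _) =
    (fun x => (- (1 / (2 * pi)) * enorm x `^ (- 2)) *: x)); last first.
  apply/funext => x; rewrite scalerA; congr (_ * _ *: _).
  by rewrite powRN powR_mulrn// enorm_ge0.
apply: cvg_grad_Phi; last by ring.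
apply: (@cvg_trans _ (- 2 * planar_factor s @[s --> 1^'-])).
  apply: (@near_eq_cvg _ _ (1 : R)^'-); near=> s.
  have s1 : s < 1 by near: s; exact: nbhs_left_lt.
  by rewrite kappa2E//; move: (planar_factor s) => A; field; rewrite subr_eq0 gt_eqF.
have -> : - (1 / (2 * pi)) = - 2 * planar_factor 1.
  by rewrite planar_factor1; move: pi (lt0r_neq0 (pi_gt0 R)) => P p0; field.
by apply: cvgM; [exact: cvg_cst|exact: cvg_planar_factor].
Unshelve. all: by end_near. Qed.

End planar.

End kernel_limits.

(** * Potentials of signed measures *)

Section charge_integrals.
Context d (T : measurableType d) (R : realType) (mu : {charge set T -> \bar R}).
Notation tv := (Defs.total_variation mu).
Notation muP := (jordan_pos (hahnP mu)).
Notation muN := (jordan_neg (hahnP mu)).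
Implicit Types f g : T -> R.

Lemma total_variation_ltoo : (tv setT < +oo)%E.
Proof.
have -> : tv setT = (muP setT + muN setT)%E by [].
by rewrite lte_add_pinfty// ltey_eq fin_num_measure.
Qed.

Lemma total_variation_eq0 A : tv A = 0%E -> muP A = 0%E /\ muN A = 0%E.
Proof.
have -> : tv A = (muP A + muN A)%E by [].
move=> /eqP; rewrite padde_eq0; [|exact: measure_ge0|exact: measure_ge0].
by move=> /andP[/eqP -> /eqP ->].
Qed.

Lemma charge_integrable_jordan f : charge_integrable mu f ->
  muP.-integrable setT (EFin \o f) /\ muN.-integrable setT (EFin \o f).
Proof.
move=> /integrableP[mf].
have -> : (\int[tv]_(x in setT) `|(EFin \o f) x| =
    \int[measure_add muP muN]_(x in setT) `|(EFin \o f) x|)%E.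
  by apply: eq_measure_integral => A mA _; exact: (esym (measure_addE muP muN A)).
rewrite ge0_integral_measure_add//; last exact: measurableT_comp.
move=> H; have P0 : (0 <= \int[muP]_x `|(EFin \o f) x|)%E by exact: integral_ge0.
have N0 : (0 <= \int[muN]_x `|(EFin \o f) x|)%E by exact: integral_ge0.
by split; apply/integrableP; split => //; apply: le_lt_trans H;
  [exact: leeDl|exact: leeDr].
Qed.

Lemma charge_integrable_bounded f (N0 : set T) (C : R) :
  measurable_fun setT f -> measurable N0 -> tv N0 = 0%E ->
  (forall y, ~ N0 y -> `|f y| <= C) -> charge_integrable mu f.
Proof.
move=> mf mN tN fC; apply/integrableP; split; first exact/measurable_EFinP.
apply: (@le_lt_trans _ _ (`|C|%:E * tv setT)%E).
  apply: integral_le_bound => //; first exact/measurable_EFinP.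
  exists N0; split => // y /= Hy; apply: contrapT => /fC H; apply: Hy => _.
  by rewrite lee_fin (le_trans H)// ler_norm.
by rewrite lte_mul_pinfty// ?lee_fin// total_variation_ltoo.
Qed.

Let le_Rintegral_dist (m : {finite_measure set T -> \bar R}) f g (N0 : set T) (e : R) :
  0 <= e ->
  m.-integrable setT (EFin \o f) -> m.-integrable setT (EFin \o g) ->
  measurable N0 -> m N0 = 0%E -> (forall y, ~ N0 y -> `|f y - g y| <= e) ->
  `|\int[m]_y f y - \int[m]_y g y| <= e * fine (m setT).
Proof.
move=> e0 intf intg mN mN0 fge.
have intfg : m.-integrable setT (EFin \o (fun y => f y - g y)).
  exact: (integrableB _ intf intg).
rewrite -RintegralB//.
apply: le_trans (le_normr_Rintegral _ _) _ => //.
rewrite -lee_fin EFinM (fineK (fin_num_measure m _ measurableT)).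
have intn : m.-integrable setT (EFin \o (fun y => `|f y - g y|)).
  exact: (integrable_abse intfg).
rewrite fineK; last exact: integrable_fin_num.
apply: (@integral_le_bound _ _ _ m _ _ (e%:E) _ (measurable_int _ intfg)) => //.
by exists N0; split => // y /= Hy; apply: contrapT => /fge H; apply: Hy.
Qed.

(** Each Jordan part is estimated separately, and their masses add up to that of the total
    variation. In the applications [N0] is the complement of the support or a single point. *)
Lemma le_charge_integral_dist f g (N0 : set T) (e : R) : 0 <= e ->
  charge_integrable mu f -> charge_integrable mu g ->
  measurable N0 -> tv N0 = 0%E -> (forall y, ~ N0 y -> `|f y - g y| <= e) ->
  `|charge_integral mu f - charge_integral mu g| <= e * fine (tv setT).
Proof.
move=> e0 /charge_integrable_jordan[fP fN] /charge_integrable_jordan[gP gN] mN.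
move=> /total_variation_eq0[P0 N00] fge.
have -> : fine (tv setT) = fine (muP setT) + fine (muN setT).
  have -> : tv setT = (muP setT + muN setT)%E by [].
  by rewrite fineD// fin_num_measure.
have E (a b a' b' : R) : a - b - (a' - b') = (a - a') + (b' - b) by ring.
rewrite mulrDr /charge_integral E (le_trans (ler_normD _ _))// lerD//.
  exact: (le_Rintegral_dist e0 fP gP mN P0 fge).
by rewrite distrC; exact: (le_Rintegral_dist e0 fN gN mN N00 fge).
Qed.

Lemma eq_charge_integral f g (N0 : set T) :
  charge_integrable mu f -> measurable_fun setT g ->
  measurable N0 -> tv N0 = 0%E -> (forall y, ~ N0 y -> f y = g y) ->
  charge_integrable mu g /\ charge_integral mu f = charge_integral mu g.
Proof.
move=> intf mg mN tN fg.
have intg : charge_integrable mu g.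
  apply/(negligible_integrable mN) => //; first exact/measurable_EFinP.
  have /(negligible_integrable mN)H := intf.
  apply: eq_integrable (H _ _ _) => //; first exact: measurableD.
    by move=> y; rewrite inE => -[_ /fg /= ->].
  by have /integrableP[] := intf.
split => //; apply/eqP; rewrite -subr_eq0 -normr_le0.
rewrite -[leRHS](mul0r (fine (tv setT))).
by apply: (le_charge_integral_dist _ _ _ mN tN) => // y /fg ->; rewrite subrr normr0.
Qed.

Lemma charge_integrableZ c f : charge_integrable mu f ->
  charge_integrable mu (fun y => c * f y).
Proof. by move=> intf; exact: (integrableZl _ c intf). Qed.

Lemma charge_integralZ c f : charge_integrable mu f ->
  charge_integral mu (fun y => c * f y) = c * charge_integral mu f.
Proof.
move=> /charge_integrable_jordan[fP fN].
by rewrite /charge_integral !RintegralZl// mulrBr.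
Qed.

Lemma continuous_charge_integral (f : R -> T -> R) (G : T -> R) (N0 : set T) (u v : R) :
  (forall s, u < s < v -> charge_integrable mu (f s)) ->
  measurable N0 -> tv N0 = 0%E ->
  (forall y, ~ N0 y -> {in `]u, v[, continuous (f ^~ y)}) ->
  charge_integrable mu G ->
  (forall s y, u < s < v -> ~ N0 y -> `|f s y| <= G y) ->
  {in `]u, v[, continuous (fun s => charge_integral mu (f s))}.
Proof.
move=> intf mN /total_variation_eq0[P0 N00] cf /charge_integrable_jordan[GP GN] fG s suv.
have uvE x : `]u, v[%classic x -> u < x < v by rewrite /= in_itv.
have K (m : {measure set T -> \bar R}) : m N0 = 0%E ->
    m.-integrable setT (EFin \o G) ->
    (forall s, u < s < v -> m.-integrable setT (EFin \o (f s))) ->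
    {for s, continuous (fun s => \int[m]_y f s y)}.
  move=> m0 intG intfm.
  have i1 x : `]u, v[%classic x -> m.-integrable setT (EFin \o f x) by move=> /uvE; exact: intfm.
  have ae1 : {ae m, forall y, setT y -> {in `]u, v[%classic, continuous (f ^~ y)}}.
    exists N0; split => // y /= Hy; apply: contrapT => Ny; apply: Hy => _.
    by move=> x /set_mem xI; apply: cf.
  have ae2 x : `]u, v[%classic x -> {ae m, forall y, setT y -> `|f x y| <= G y}.
    move=> /uvE xI; exists N0; split => // y /= Hy; apply: contrapT => Ny.
    by apply: Hy => _; exact: fG.
  apply: (continuity_under_integral measurableT i1 ae1 intG ae2).
  by rewrite inE.
apply: cvgB.
  by apply: K => // x /intf/charge_integrable_jordan[].
by apply: K => // x /intf/charge_integrable_jordan[].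
Qed.

End charge_integrals.

(** * Measurability of kernels and the support of a charge *)

Section borel.
Context {R : realType} {n : nat}.
Notation rV := 'rV[R]_n.
Notation T := (borel_rV R n).

Lemma borel_open (U : set rV) : open U -> measurable (U : set T).
Proof. by move=> oU; exact: sub_sigma_algebra. Qed.

Lemma borel_closed (U : set rV) : closed U -> measurable (U : set T).
Proof. by move=> /closed_openC/borel_open/measurableC; rewrite setCK. Qed.

Lemma borel_set1 (x : rV) : measurable ([set x] : set T).
Proof.
by apply: borel_closed; apply: accessible_closed_set1; apply: hausdorff_accessible;
  exact: norm_hausdorff.
Qed.

Lemma continuous_on_open_measurable (D : set rV) (f : rV -> R) : open D ->
  (forall x, D x -> {for x, continuous f}) -> measurable_fun (D : set T) f.
Proof.
move=> oD cf; apply: (measurability _ (RGenOpens.measurableE R)).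
move=> _ [_ [a [b ->] <-]]; apply: borel_open.
rewrite openE => x [Dx fx] /=.
apply: filterI; first exact: open_nbhs_nbhs.
apply: (cf x Dx); apply: open_nbhs_nbhs; split => //; exact: interval_open.
Qed.

(** The kernel may jump at the origin, that is, at [y = x]; this point is split off. *)
Lemma measurable_sub_kernel (K : rV -> R) (x : rV) :
  (forall z, z != 0 -> {for z, continuous K}) ->
  measurable_fun [set: T] (fun y : rV => K (x - y)).
Proof.
move=> cK.
have -> : [set: T] = ~` [set x] `|` [set x] by rewrite setUC setUv.
have ox : open (~` [set x]).
  by rewrite openC; apply: accessible_closed_set1; apply: hausdorff_accessible;
    exact: norm_hausdorff.
apply/measurable_funU; [exact: borel_open|exact: borel_set1|split].
  apply: continuous_on_open_measurable => // y yx.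
  apply: (@continuous_comp _ _ _ (fun y : rV => x - y) K).
    by apply: continuousB; [exact: cst_continuous|exact: cvg_id].
  by apply: cK; rewrite subr_eq0; apply/eqP => xy; apply: yx.
by apply: measurable_fun_set1; exact: borel_set1.
Qed.

(** A countable base of balls, by which the complement of the support becomes a countable union of
    null balls. *)
Lemma rational_ball (x : rV) (e : R) : 0 < e ->
  exists (q : 'rV[rat]_n) (k : nat),
    ball (map_mx ratr q : rV) k.+1%:R^-1 x /\
    ball (map_mx ratr q : rV) k.+1%:R^-1 `<=` ball x e.
Proof.
move=> e0; pose k := Num.truncn (2 / e).
have ke : k.+1%:R^-1 < e / 2.
  by rewrite -[ltRHS]invrK ltf_pV2 ?posrE ?invr_gt0 ?divr_gt0// invf_div truncnS_gt.
have k0 : 0 < k.+1%:R^-1 :> R by rewrite invr_gt0.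
have H (i : 'I_n) : exists q : rat, `|ratr q - x ord0 i| < k.+1%:R^-1.
  have /rat_in_itvoo[q] : x ord0 i - k.+1%:R^-1 < x ord0 i + k.+1%:R^-1.
    by rewrite ltrD2l gtrN.
  rewrite in_itv/= => /andP[q1 q2]; exists q.
  by rewrite ltr_distl q1 q2.
have [q Hq] := fin_all_exists H.
have B : ball (map_mx ratr (\row_i q i) : rV) k.+1%:R^-1 x.
  by split=> // i j; rewrite !mxE (ord1 i) /ball/=; exact: Hq.
exists (\row_i q i), k; split => // y qy.
have b1 := ball_sym (le_ball (ltW ke) B).
have b2 := le_ball (ltW ke) qy.
by have := ball_triangle b1 b2; rewrite -splitr.
Qed.

Lemma borel_ball (x : rV) (e : R) : measurable (ball x e : set T).
Proof. by apply: borel_open; exact: ball_open. Qed.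

Variable mu : {charge set T -> \bar R}.
Notation tv := (Defs.total_variation mu).

Lemma not_suppP (x : rV) : ~ supp mu x <->
  exists2 e : R, 0 < e & tv (ball x e) = 0%E.
Proof.
split=> [|[e e0 te] H].
  move=> /existsNP[U /not_implyP[oU /not_implyP[Ux /negP]]].
  rewrite -leNgt => tU.
  have /nbhs_ballP[e /= e0 eU] : nbhs x U by exact: open_nbhs_nbhs.
  exists e => //; apply/eqP; rewrite -measure_le0 (le_trans _ tU)// le_measure ?inE//.
    exact: borel_ball.
  exact: borel_open.
have := H (ball x e) (ball_open x e) (ballxx x e0).
by rewrite te ltxx.
Qed.

Lemma closed_supp : closed (supp mu).
Proof.
rewrite -[supp mu]setCK closedC openE => x /not_suppP[e e0 te].
apply/nbhs_ballP; exists (e / 2); first by rewrite /= divr_gt0.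
move=> y xy; apply/not_suppP; exists (e / 2); first by rewrite divr_gt0.
apply/eqP; rewrite -measure_le0 -te le_measure ?inE//.
- exact: borel_ball.
- exact: borel_ball.
- by move=> z yz; rewrite (splitr e); exact: ball_triangle yz.
Qed.

Lemma total_variation_suppC : tv (~` supp mu) = 0%E.
Proof.
pose B (p : 'rV[rat]_n * nat) : set rV := ball (map_mx ratr p.1 : rV) p.2.+1%:R^-1.
(* [F] enumerates the balls of the base and replaces those of positive variation by the empty
   set. *)
pose F (m : nat) : set T :=
  if unpickle m is Some p then if tv (B p) == 0%E then B p else set0 else set0.
have mB p : measurable (B p : set T) by exact: borel_ball.
have mF m : measurable (F m) by rewrite /F; case: unpickle => // p; case: ifP.
have F0 m : tv (F m) = 0%E.
  by rewrite /F; case: unpickle => [p|]; [case: ifP => [/eqP//|_]|]; exact: measure0.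
have sub : ~` supp mu `<=` \bigcup_m F m.
  move=> x /not_suppP[e e0 te]; have [q [k [qx qe]]] := rational_ball x e0.
  exists (pickle (q, k)) => //; rewrite /F pickleK ifT//.
  rewrite -measure_le0 -te le_measure ?inE//; exact: borel_ball.
apply/eqP; rewrite -measure_le0.
have mS : measurable (~` supp mu : set T) by apply: borel_open; apply: closed_openC; exact: closed_supp.
apply: (le_trans (@measure_sigma_subadditive _ _ _ tv _ _ mF mS sub)).
by rewrite eseries0// => m _ _; exact: F0.
Qed.

End borel.

(** * From finite Riesz potentials to integrable kernels *)

Section layer_cake.
Context d (T : measurableType d) (R : realType).
Variables (m : {finite_measure set T -> \bar R}) (r : T -> R) (p : R).
Hypotheses (mr : measurable_fun setT r) (r_ge0 : forall y, 0 <= r y) (p0 : 0 < p).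
Notation mu := (@lebesgue_measure R).

(** The weight of the Riesz potential on positive radii. As [r] is nonnegative, [g] sees no other
    radii. *)
Let w (rho : R) : R := rho `^ (- p) * rho `^ (- 1).

Let w_ge0 rho : 0 <= w rho.
Proof. by rewrite mulr_ge0 ?powR_ge0. Qed.

Let measurable_w : measurable_fun setT w.
Proof. by apply: measurable_funM; exact: measurable_powR. Qed.

Let g (z : T * R) : \bar R := if r z.1 < z.2 then (w z.2)%:E else 0%E.

Let g_ge0 z : (0 <= g z)%E.
Proof. by rewrite /g; case: ifP => // _; rewrite lee_fin. Qed.

Let measurable_g : measurable_fun setT g.
Proof.
apply: measurable_fun_ifT => //.
- by apply: measurable_fun_ltr; [apply: measurableT_comp mr _; exact: measurable_fst|exact: measurable_snd].
- apply/measurable_EFinP; apply: (measurableT_comp measurable_w).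
  exact: measurable_snd.
Qed.

Let measurable_g_section y : measurable_fun setT (fun rho : R => g (y, rho)).
Proof.
apply: (measurableT_comp measurable_g).
exact: measurable_fun_pair.
Qed.

(** The interval []t, 2t]] has length [t] and its smallest weight is [(2t)^(-p) / (2t)]; their
    product is [c * t^(-p)]. *)
Let c : R := 2 `^ (- p) / 2.

Let c_gt0 : 0 < c.
Proof. by rewrite divr_gt0// powR_gt0. Qed.

(* The radii in ]t, 2t] alone recover [t^(-p)] up to a constant. *)
Let le_integral_g y (t : R) : 0 < t -> r y <= t ->
  ((c * t `^ (- p))%:E <= \int[mu]_(rho in [set: R]) g (y, rho))%E.
Proof.
move=> t0 ryt; have t2 : t < 2 * t by rewrite ltr_pMl// ltr1n.
have t20 : 0 < 2 * t by rewrite mulr_gt0.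
apply: (@le_trans _ _ (\int[mu]_(rho in `]t, (2 * t)%R]) (w (2 * t))%:E)%E).
  rewrite integral_cst//= lebesgue_measure_itv/= lte_fin t2 -EFinB -EFinM lee_fin.
  rewrite /w powRM ?(ltW t0)// (powR_inv1 (ltW t20)) /c le_eqVlt; apply/orP; left.
  by apply/eqP; field; rewrite gt_eqF.
apply: (@le_trans _ _ (\int[mu]_(rho in `]t, (2 * t)%R]) g (y, rho))%E).
  apply: ge0_le_integral => //.
  - by move=> x _; rewrite lee_fin.
  - by apply: measurable_funTS; exact: measurable_g_section.
  - move=> rho; rewrite /= in_itv/= => /andP[t1 t3].
    rewrite /g /= (le_lt_trans ryt t1) lee_fin /w.
    have rho0 : 0 < rho by exact: lt_trans t1.
    have H q : 0 < q -> (2 * t) `^ (- q) <= rho `^ (- q).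
      move=> q0; rewrite !powRN lef_pV2 ?posrE ?powR_gt0//.
      by rewrite ge0_ler_powR ?nnegrE ?(ltW q0) ?(ltW rho0) ?(ltW t20).
    by rewrite ler_pM ?powR_ge0 ?H.
by apply: ge0_subset_integral => //; exact: measurable_g_section.
Qed.

(** As [powR] sends 0 to 0 for the exponent [- p], the first conclusion says nothing about the set
    where [r] vanishes; it must be shown null separately. *)
Lemma layer_cake_finite :
  (\int[mu]_(rho in `]0%R, +oo[)
     (m [set y | (r y < rho)%R] * ((rho `^ p)^-1 / rho)%:E) < +oo)%E ->
  (\int[m]_y (r y `^ (- p))%:E < +oo)%E /\ m [set y | r y = 0%R] = 0%E.
Proof.
move=> H.
have mlt rho : measurable [set y | r y < rho].
  rewrite (_ : mkset _ = setT `&` (fun y => r y < cst rho y) @^-1` [set true]).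
    exact: measurable_fun_ltr.
  by rewrite setTI; apply/seteqP; split => y /=.
have {}H : (\int[m]_y \int[mu]_rho g (y, rho) < +oo)%E.
  apply: le_lt_trans H; rewrite [leRHS]integral_mkcond.
  rewrite le_eqVlt; apply/orP; left; apply/eqP.
  have E := @fubini_tonelli _ _ _ _ _ m mu g measurable_g g_ge0.
  apply: (etrans E); apply: eq_integral => rho _.
  rewrite patchE; case: ifPn.
    rewrite inE/= in_itv/= andbT => rho0.
    have -> : (rho `^ p)^-1 / rho = w rho by rewrite /w powR_inv1 ?(ltW rho0)// powRN.
    rewrite muleC -integral_cst//= [RHS]integral_mkcond.
    apply: eq_integral => y _; rewrite patchE /g /=.
    by case: ifPn => [ryr|/negP ryr]; [rewrite mem_set|rewrite memNset].
  rewrite notin_setE/= in_itv/= andbT => /negP; rewrite -leNgt => rho0.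
  rewrite integral0_eq// => y _; rewrite /g/= ifF//.
  by apply/negbTE; rewrite -leNgt (le_trans rho0).
have mF : measurable_fun setT (fun y => \int[mu]_rho g (y, rho))%E.
  exact: (@measurable_fun_fubini_tonelli_F _ _ _ _ _ mu g measurable_g g_ge0).
have J0 y : (0 <= \int[mu]_rho g (y, rho))%E by exact: integral_ge0.
split.
  apply: (@le_lt_trans _ _ (\int[m]_y (c^-1%:E * \int[mu]_rho g (y, rho)))%E).
    apply: ge0_le_integral => //.
    - by move=> y _; rewrite lee_fin powR_ge0.
    - by apply/measurable_EFinP; apply: (measurableT_comp (measurable_powR _)).
    - exact: measurable_funeM.
    move=> y _; have := r_ge0 y; rewrite le_eqVlt => /predU1P[<-|ry0].
      rewrite powR0 ?oppr_eq0 ?gt_eqF// mule_ge0// lee_fin invr_ge0; exact: ltW.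
    have := le_integral_g ry0 (lexx _).
    have c1 : (0 <= c^-1%:E)%E by rewrite lee_fin invr_ge0; exact: ltW.
    move=> /(lee_wpmul2l c1); apply: le_trans.
    by rewrite -EFinM mulKf// gt_eqF.
  rewrite ge0_integralZl//; last by rewrite lee_fin invr_ge0; exact: ltW.
  by rewrite lte_mul_pinfty// lee_fin invr_ge0; exact: ltW.
pose Z := [set y | r y = 0].
have mZ : measurable Z.
  by rewrite -[Z]setTI; exact: (mr measurableT (measurable_set1 0)).
apply/eqP; rewrite -[_ == _]negbK; apply/negP => mZ0.
have [a aE] : exists a : R, m Z = a%:E.
  by exists (fine (m Z)); rewrite fineK// fin_num_measure.
have a0 : 0 < a.
  by rewrite -lte_fin -aE lt_neqAle measure_ge0 andbT eq_sym.
have Jfin : (\int[m]_y \int[mu]_rho g (y, rho))%E \is a fin_num.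
  by rewrite ge0_fin_numE// integral_ge0.
pose B := fine (\int[m]_y \int[mu]_rho g (y, rho))%E.
have B0 : 0 <= B by rewrite fine_ge0// integral_ge0.
(* Where [r] vanishes, the inner integral is at least [c * t^(-p)] for every [t > 0]. If that set
   had mass [a > 0], the choice [t^(-p) = X] would push the total to [B + 1], above its value
   [B]. *)
pose X := (B + 1) / (c * a).
have X0 : 0 < X by rewrite divr_gt0 ?mulr_gt0// ltr_wpDl.
pose t := X `^ (- p^-1).
have t0 : 0 < t by rewrite powR_gt0.
have tp : t `^ (- p) = X.
  by rewrite /t -powRrM mulrNN mulVf ?gt_eqF// powRr1// ltW.
have : ((c * t `^ (- p) * a)%:E <= B%:E)%E.
  rewrite /B fineK// EFinM -aE -integral_cst//.
  apply: (@le_trans _ _ (\int[m]_(y in Z) \int[mu]_rho g (y, rho))%E).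
    apply: ge0_le_integral => //.
    - by move=> y _; rewrite lee_fin mulr_ge0 ?powR_ge0//; exact: ltW.
    - by apply: measurable_funTS; exact: mF.
    - by move=> y ry; apply: le_integral_g => //; rewrite ry; exact: ltW.
  exact: ge0_subset_integral.
rewrite lee_fin tp /X (_ : c * _ * a = B + 1); last by field; rewrite !gt_eqF.
by rewrite gerDl ler10.
Qed.

End layer_cake.

Section finite_variation.
Context d (T : measurableType d) (R : realType) (nu : {charge set T -> \bar R}).
Variables (P N : set T) (nuPN : hahn_decomposition nu P N).

(** [total_variation] is typed as a mere measure; this instance lets [riesz_finite] use its
    underlying [charge_variation] as a finite measure. *)
Let charge_variation_fin : fin_num_fun (charge_variation nuPN).
Proof. by move=> A mA; rewrite fin_numD !fin_num_measure. Qed.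

HB.instance Definition _ := @Measure_isFinite.Build _ _ _
  (charge_variation nuPN) charge_variation_fin.

End finite_variation.

(** * Potentials off the support and at its points *)

Section potentials.
Context {R : realType} {n : nat}.
Notation rV := 'rV[R]_n.
Notation T := (borel_rV R n).
Variable mu : {charge set T -> \bar R}.
Notation tv := (Defs.total_variation mu).

Lemma continuous_enorm_sub (x : rV) : continuous (fun y : rV => enorm (x - y)).
Proof.
move=> y; apply: (@continuous_comp _ _ _ (fun y : rV => x - y) (@enorm R n)).
  by apply: continuousB; [exact: cst_continuous|exact: cvg_id].
exact: continuous_enorm.
Qed.

Lemma riesz_finite (beta : R) (x : rV) : beta < n%:R ->
  (riesz beta mu x < +oo)%E ->
  charge_integrable mu (fun y : rV => enorm (x - y) `^ (beta - n%:R)) /\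
  tv [set x] = 0%E.
Proof.
move=> bn H; pose r : T -> R := fun y : rV => enorm (x - y).
have mr : measurable_fun [set: T] r.
  apply: continuous_on_open_measurable; first exact: openT.
  by move=> y _; exact: continuous_enorm_sub.
have p0 : 0 < n%:R - beta by rewrite subr_gt0.
have r0 y : 0 <= r y by exact: enorm_ge0.
have [|I Z] := @layer_cake_finite _ T R (charge_variation (hahnP mu)) r (n%:R - beta) mr r0 p0.
  apply: le_lt_trans H; rewrite le_eqVlt; apply/orP; left; apply/eqP.
  apply: eq_integral => rho _; congr (_ * _)%E; congr (charge_variation _ _).
  by apply/seteqP; split => y /=; rewrite /eball /r /= -enormN opprB.
split.
  apply/integrableP; split.
    apply/measurable_EFinP; apply: (measurableT_comp (measurable_powR _) mr).
  apply: le_lt_trans I; rewrite le_eqVlt; apply/orP; left; apply/eqP.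
  by apply: eq_integral => y _; rewrite /= ger0_norm ?powR_ge0// opprB.
rewrite -Z; congr (charge_variation _ _).
apply/seteqP; split => y /=; rewrite /r.
  by move=> ->; apply/eqP; rewrite enorm_eq0 subrr.
by move/eqP; rewrite enorm_eq0 subr_eq0 => /eqP.
Qed.

(* A kernel enters a potential at a point off the support only through its values
   on the compact set x - supp mu, which avoids the origin. *)
Lemma compact_differences (K : set rV) : compact K -> K `<=` ~` supp mu ->
  compact (supp mu) ->
  compact [set z : rV | exists x y, [/\ K x, supp mu y & z = x - y]] /\
  [set z : rV | exists x y, [/\ K x, supp mu y & z = x - y]] `<=` ~` [set 0].
Proof.
move=> cK Ks cs; split.
  have -> : [set z : rV | exists x y, [/\ K x, supp mu y & z = x - y]] =
      (fun p : rV * rV => p.1 - p.2) @` (K `*` supp mu).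
    apply/seteqP; split => [z [x [y [Kx sy ->]]]|z [[x y] [Kx sy] <-]].
      by exists (x, y).
    by exists x, y.
  apply: continuous_compact; last exact: compact_setX.
  apply: continuous_subspaceT => p.
  apply: (@cvgB _ _ _ (nbhs p)); [exact: cvg_fst|exact: cvg_snd].
move=> z [x [y [Kx sy ->]]] /eqP; rewrite subr_eq0 => /eqP xy.
by apply: (Ks _ Kx); rewrite xy.
Qed.

Lemma borel_supp : measurable (supp mu : set T).
Proof. by apply: borel_closed; exact: closed_supp. Qed.

Lemma potential_exists_off_supp (k : rV -> R) (x : rV) :
  (forall z, z != 0 -> {for z, continuous k}) -> compact (supp mu) ->
  ~ supp mu x -> potential_exists k mu x.
Proof.
move=> ck cs xs.
have Ks : [set x] `<=` ~` supp mu by move=> _ ->.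
have [cD D0] := compact_differences (@compact_set1 _ x) Ks cs.
have cKD : compact (k @` [set z : rV | exists x' y, [/\ [set x] x', supp mu y & z = x' - y]]).
  apply: continuous_compact cD; apply: continuous_in_subspaceT => z.
  by rewrite inE => /D0 z0; apply: ck; exact/eqP.
have [M [_ HM]] := compact_bounded cKD.
pose C := `|M| + 1.
apply: (@charge_integrable_bounded _ _ _ mu _ (~` supp mu) C).
- exact: measurable_sub_kernel.
- by apply: measurableC; exact: borel_supp.
- exact: total_variation_suppC.
move=> y /contrapT sy; apply: (HM C); first by rewrite /C (le_lt_trans (ler_norm _))// ltrDl.
by exists (x - y) => //; exists x, y.
Qed.

Lemma cvg_potential_off_supp (k : R -> rV -> R) (k0 : rV -> R) (F : set_system R) :
  Filter F -> compact (supp mu) ->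
  (forall s z, z != 0 -> {for z, continuous (k s)}) ->
  (forall z, z != 0 -> {for z, continuous k0}) ->
  {family compactly_in (~` [set (0 : rV)]), k @ F --> k0} ->
  {family compactly_in (~` supp mu), (fun s => potential (k s) mu) @ F -->
    potential k0 mu}.
Proof.
move=> FF cs ck ck0 /compactly_in_cvgP H; apply/compactly_in_cvgP => K Ks cK e e0.
have [cD D0] := compact_differences cK Ks cs.
pose C := fine (tv setT).
have C0 : 0 <= C by rewrite fine_ge0.
have C1 : 0 < C + 1 by rewrite ltr_wpDl.
(* [C + 1] rather than [C], as the total variation may vanish. *)
have e'0 : 0 < e / (C + 1) by rewrite divr_gt0.
apply: filterS (H _ D0 cD _ e'0) => s Hs x Kx.
have xs := Ks _ Kx.
apply: (@le_lt_trans _ _ (e / (C + 1) * C)); last first.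
  by rewrite mulrAC ltr_pdivrMr// ltr_pM2l// ltrDl.
apply: (le_charge_integral_dist (ltW e'0) _ _ (measurableC borel_supp)
  (total_variation_suppC mu)).
- exact: potential_exists_off_supp.
- by apply: potential_exists_off_supp => // z; exact: ck.
- by move=> y /contrapT sy; apply/ltW/Hs; exists x, y.
Qed.

Lemma ltr_row_norm (v : rV) (e : R) : 0 < e ->
  (forall i, `|v ord0 i| < e) -> `|v| < e.
Proof.
move=> e0 H; have : ball (0 : rV) e (- v).
  by split=> // i j; rewrite (ord1 i) -ball_normE/= !mxE sub0r opprK; exact: H.
by rewrite -ball_normE/= sub0r opprK.
Qed.

Lemma ltr_coord_norm (v : rV) (e : R) i : `|v| < e -> `|v ord0 i| < e.
Proof.
move=> H; have : ball (0 : rV) e (- v) by rewrite -ball_normE/= sub0r opprK.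
by move=> [_ /(_ ord0 i)]; rewrite -ball_normE/= !mxE sub0r opprK.
Qed.

Lemma continuous_coord_comp (k : rV -> rV) i (z : rV) : {for z, continuous k} ->
  {for z, continuous (fun z => k z ord0 i)}.
Proof.
move=> ck; apply: (@continuous_comp _ _ _ k (fun v : rV => v ord0 i)) => //.
exact: coord_continuous.
Qed.

Lemma cvg_vpotential_off_supp (k : R -> rV -> rV) (k0 : rV -> rV) (F : set_system R) :
  Filter F -> compact (supp mu) ->
  (forall s z, z != 0 -> {for z, continuous (k s)}) ->
  (forall z, z != 0 -> {for z, continuous k0}) ->
  {family compactly_in (~` [set (0 : rV)]), k @ F --> k0} ->
  {family compactly_in (~` supp mu), (fun s => vpotential (k s) mu) @ F -->
    vpotential k0 mu}.
Proof.
move=> FF cs ck ck0 /compactly_in_cvgP H; apply/compactly_in_cvgP => K Ks cK e e0.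
have Hi (i : 'I_n) : \forall s \near F, forall x, K x ->
    `|potential (fun z => k0 z ord0 i) mu x - potential (fun z => k s z ord0 i) mu x| < e.
  have Hk : {family compactly_in (~` [set (0 : rV)]),
      (fun s z => k s z ord0 i) @ F --> (fun z => k0 z ord0 i)}.
    apply/compactly_in_cvgP => D D0 cD e' e'0.
    apply: filterS (H D D0 cD e' e'0) => s Hs y Dy.
    by have := ltr_coord_norm i (Hs y Dy); rewrite !mxE.
  have /compactly_in_cvgP := @cvg_potential_off_supp (fun s z => k s z ord0 i)
    (fun z => k0 z ord0 i) F FF cs
    (fun s z z0 => continuous_coord_comp (ck s z z0))
    (fun z z0 => continuous_coord_comp (ck0 z z0)) Hk.
  exact.
have := @filter_forall _ _ _ F FF Hi; apply: filterS => s Hs x Kx.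
by apply: ltr_row_norm => // i; rewrite !mxE; exact: Hs.
Qed.

(** Dominated convergence for [h] alone: once the scalar [c s] is split off, it needs to converge
    but not to be bounded on all of []u, v[]. The [+ 1] in the majorant is integrable because the
    total variation is finite, and the hypotheses on [z != 0] suffice because [[set x]] is null. *)
Lemma cvg_potential_at (k h : R -> rV -> R) (c : R -> R) (x : rV) (u v q s0 : R) :
  u < s0 < v -> tv [set x] = 0%E ->
  charge_integrable mu (fun y : rV => enorm (x - y) `^ q) ->
  (forall s z, z != 0 -> {for z, continuous (k s)}) ->
  (forall s z, z != 0 -> {for z, continuous (h s)}) ->
  (forall z, z != 0 -> continuous (h ^~ z)) ->
  (forall s z, z != 0 -> k s z = c s * h s z) ->
  (forall s z, u < s < v -> z != 0 -> `|h s z| <= enorm z `^ q + 1) ->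
  c s @[s --> s0] --> c s0 ->
  (forall s, u < s < v -> potential_exists (k s) mu x) /\
  potential (k s) mu x @[s --> s0] --> potential (k s0) mu x.
Proof.
move=> us0v tx Iq ck ch chs kE hq cc.
have mx : measurable ([set x] : set T) by exact: borel_set1.
have x0 (y : rV) : ~ [set x] y -> x - y != 0.
  by move=> xy; rewrite subr_eq0; apply/eqP => yx; apply: xy.
have IG : charge_integrable mu (fun y : rV => enorm (x - y) `^ q + 1).
  have I1 : charge_integrable mu (cst 1).
    apply: (@charge_integrable_bounded _ _ _ mu (cst 1) set0 1) => //.
    by move=> y _; rewrite normr1.
  exact: (integrableD measurableT Iq I1).
have mh s : measurable_fun [set: T] (fun y : rV => h s (x - y)).
  by apply: measurable_sub_kernel; exact: ch.
have Ih s : u < s < v -> charge_integrable mu (fun y : rV => h s (x - y)).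
  move=> usv; have /(negligible_integrable mx) H := IG.
  apply/(negligible_integrable mx) => //; first by apply/measurable_EFinP; exact: mh.
  have mG : measurable_fun [set: T] (EFin \o (fun y : rV => enorm (x - y) `^ q + 1)).
    exact: measurable_int IG.
  apply: (le_integrable _ _ _ (H measurableT mG tx)) => //.
  - exact: measurableD.
  - by apply: measurable_funTS; apply/measurable_EFinP; exact: mh.
  - move=> y [_ /x0 y0]; rewrite lee_fin (le_trans (hq s _ usv y0))//.
    exact: ler_norm.
have Ek s : u < s < v -> charge_integrable mu (fun y : rV => k s (x - y)) /\
    c s * charge_integral mu (fun y : rV => h s (x - y)) =
    charge_integral mu (fun y : rV => k s (x - y)).
  move=> usv; rewrite -charge_integralZ; last exact: Ih.
  apply: (eq_charge_integral _ _ mx tx).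
  - by apply: charge_integrableZ; exact: Ih.
  - by apply: measurable_sub_kernel; exact: ck.
  - by move=> y /x0 y0; rewrite kE.
split; first by move=> s /Ek[].
have /andP[us0 s0v] := us0v.
rewrite /potential -(Ek _ us0v).2.
apply: (@cvg_trans _ (c s * charge_integral mu (fun y : rV => h s (x - y)) @[s --> s0])).
  apply: (@near_eq_cvg _ _ (nbhs s0)); near=> s; rewrite (Ek s _).2//.
  apply/andP; split; near: s.
    exact: lt_nbhsr.
  exact: lt_nbhsl.
apply: (@cvgM _ _ (nbhs s0)) => //.
apply: (@continuous_charge_integral _ _ _ mu (fun s (y : rV) => h s (x - y))
  (fun y : rV => enorm (x - y) `^ q + 1) [set x] u v) => //.
- by move=> y /x0 y0 s _; exact: chs.
- by move=> s y usv /x0; exact: hq.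
Unshelve. all: by end_near. Qed.

End potentials.

(** * Convergence of the potentials *)

Section riesz_points.
Context {R : realType} {n : nat}.
Notation rV := 'rV[R]_n.
Variable mu : {charge set (borel_rV R n) -> \bar R}.
Hypothesis n3 : (3 <= n)%N.

Let n3R : 3 <= n%:R :> R.
Proof. by rewrite ler_nat. Qed.

Let continuous_enorm_powR (a b : R) (z : rV) : z != 0 ->
  continuous (fun s : R => enorm z `^ (2 * s - a - b)).
Proof.
move=> z0 s; apply: (@continuous_comp _ _ _ (fun s : R => 2 * s - a - b)
  (fun p => enorm z `^ p)); last by apply: continuous_powR_exponent; rewrite enorm_gt0.
apply: cvgB; last exact: cvg_cst.
apply: cvgB; last exact: cvg_cst.
by apply: cvgM; [exact: cvg_cst|exact: cvg_id].
Qed.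

Let powR_le_add1 (q a t : R) : 0 < t -> q <= a <= 0 -> t `^ a <= t `^ q + 1.
Proof. by move=> t0 qa; rewrite -[X in _ + X](powRr0 t); exact: powR_le_ends. Qed.

(** The range of [s] keeps the exponent [2 s - n] between [2 - delta - n], reached at
    [s = 1 - delta / 2], and 0, since [2 s < 3 <= n]. *)
Lemma cvg_potential_Phi (x : rV) (delta : R) : 0 < delta < 1 ->
  (riesz (2 - delta) mu x < +oo)%E ->
  (forall s, 1 - delta / 2 < s < 3 / 2 -> potential_exists (Phi s) mu x) /\
  potential (Phi s) mu x @[s --> (1 : R)] --> potential (Phi 1) mu x.
Proof.
have n3' := n3R.
move=> /andP[d0 d1] /riesz_finite[|I x0]; first by lra.
apply: (@cvg_potential_at _ _ mu (@Phi R n)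
  (fun s z => 1 * enorm z `^ (2 * s - n%:R)) (kappa n) x _ _ _ _ _ x0 I).
- by apply/andP; split; lra.
- by move=> s z; exact: continuous_cst_powR_enorm.
- by move=> s z; exact: continuous_cst_powR_enorm.
- move=> z z0; rewrite (_ : (fun s : R => _) = fun s => enorm z `^ (2 * s - n%:R - 0)).
    exact: continuous_enorm_powR.
  by apply/funext => s; rewrite mul1r subr0.
- by move=> s z _; rewrite mul1r.
- move=> s z /andP[s1 s2] z0; rewrite mul1r ger0_norm ?powR_ge0//.
  apply: powR_le_add1; first by rewrite enorm_gt0.
  by apply/andP; split; lra.
- exact: cvg_kappa.
Qed.

(** The gradient has size [|z|^(2s-n-1)], one order lower than the kernel. Lowering the Riesz order
    by one as well leaves the range of [s] unchanged. *)
Lemma cvg_potential_grad_Phi (x : rV) (delta : R) (i : 'I_n) : 0 < delta < 1 ->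
  (riesz (1 - delta) mu x < +oo)%E ->
  (forall s, 1 - delta / 2 < s < 3 / 2 ->
     potential_exists (fun z => grad (Phi s) z ord0 i) mu x) /\
  potential (fun z => grad (Phi s) z ord0 i) mu x @[s --> (1 : R)] -->
  potential (fun z => grad (Phi 1) z ord0 i) mu x.
Proof.
have n3' := n3R.
move=> /andP[d0 d1] /riesz_finite[|I x0]; first by lra.
apply: (@cvg_potential_at _ _ mu (fun s z => grad (@Phi R n s) z ord0 i)
  (fun s z => 1 * enorm z `^ (2 * s - n%:R - 2) * z ord0 i)
  (fun s => kappa n s * (2 * s - n%:R)) x _ _ _ _ _ x0 I).
- by apply/andP; split; lra.
- by move=> s z z0; apply: continuous_coord_comp; exact: continuous_grad_Phi.
- move=> s z z0; apply: continuousM; first exact: continuous_cst_powR_enorm.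
  exact: coord_continuous.
- move=> z z0 s; apply: cvgM; last exact: cvg_cst.
  apply: cvgM; first exact: cvg_cst.
  exact: continuous_enorm_powR.
- by move=> s z z0; rewrite grad_Phi// mxE mul1r mulrA.
- move=> s z /andP[s1 s2] z0; rewrite mul1r normrM ger0_norm ?powR_ge0//.
  have e0 : 0 < enorm z by rewrite enorm_gt0.
  apply: (@le_trans _ _ (enorm z `^ (2 * s - n%:R - 1))).
    have -> : 2 * s - n%:R - 1 = (2 * s - n%:R - 2) + 1 by ring.
    rewrite [leRHS]powRD ?(gt_eqF e0) ?implybT// powRr1 ?(ltW e0)//.
    by rewrite ler_wpM2l ?powR_ge0// coord_le_enorm.
  apply: powR_le_add1 => //.
  by apply/andP; split; lra.
- apply: cvgM; first exact: cvg_kappa.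
  apply: cvgB; last exact: cvg_cst.
  by apply: cvgM; [exact: cvg_cst|exact: cvg_id].
Qed.

End riesz_points.

Lemma near_left1 (R : realType) (u v : R) : u < 1 < v -> \forall s \near 1^'-, u < s < v.
Proof.
move=> /andP[u1 v1]; near=> s; apply/andP; split.
  by near: s; exact: nbhs_left_gt.
by apply: lt_trans v1; near: s; exact: nbhs_left_lt.
Unshelve. all: by end_near. Qed.

Theorem theorem2p7 (R : realType) :
  [/\ (* (1) *)
      forall n : nat, (3 <= n)%N ->
        {family compactly_in (~` [set (0 : 'rV[R]_n)]),
           (fun s : R => @Phi R n s) @ 1^'- --> @Phi1 R n} /\
        (forall mu : {charge set (borel_rV R n) -> \bar R}, compact (supp mu) ->
           [/\ (forall (s : R) (x : 'rV[R]_n), 1 / 2 < s < 1 -> ~ supp mu x ->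
                  potential_exists (@Phi R n s) mu x /\
                  vpotential_exists (grad (@Phi R n s)) mu x),
               (forall x : 'rV[R]_n, ~ supp mu x ->
                  potential_exists (@Phi1 R n) mu x /\
                  vpotential_exists (grad (@Phi1 R n)) mu x),
               {family compactly_in (~` supp mu),
                  (fun s : R => potential (@Phi R n s) mu) @ 1^'- -->
                  potential (@Phi1 R n) mu} /\
               {family compactly_in (~` supp mu),
                  (fun s : R => vpotential (grad (@Phi R n s)) mu) @ 1^'- -->
                  vpotential (grad (@Phi1 R n)) mu},
               (forall x : 'rV[R]_n, supp mu x ->
                  (exists2 delta : R, 0 < delta < 1 &
                     (riesz (2 - delta) mu x < +oo)%E) ->
                  [/\ \forall s \near 1^'-, potential_exists (@Phi R n s) mu x,
                      potential_exists (@Phi1 R n) mu x &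
                      (fun s : R => potential (@Phi R n s) mu x) @ 1^'- -->
                      potential (@Phi1 R n) mu x]) &
               (forall x : 'rV[R]_n, supp mu x ->
                  (exists2 delta : R, 0 < delta < 1 &
                     (riesz (1 - delta) mu x < +oo)%E) ->
                  [/\ \forall s \near 1^'-,
                        vpotential_exists (grad (@Phi R n s)) mu x,
                      vpotential_exists (grad (@Phi1 R n)) mu x &
                      (fun s : R => vpotential (grad (@Phi R n s)) mu x) @ 1^'- -->
                      vpotential (grad (@Phi1 R n)) mu x])]),
      (* (2) *)
      (exists c0 : R,
         {family compactly_in (~` [set (0 : 'rV[R]_2)]),
            (fun (s : R) (x : 'rV[R]_2) => Phi s x - 1 / (4 * pi * (1 - s)))
              @ 1^'- -->
            (fun x : 'rV[R]_2 => - (1 / (2 * pi)) * ln (enorm x) + c0)}) /\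
      {family compactly_in (~` [set (0 : 'rV[R]_2)]),
         (fun s : R => grad (@Phi R 2 s)) @ 1^'- -->
         (fun x : 'rV[R]_2 =>
            (- (1 / (2 * pi))) *: ((enorm x ^+ 2)^-1 *: x))} &
      (* (3) *)
      forall n : nat, (2 <= n)%N ->
        (fun s : R => n%:R / (n%:R - 2 * s + 1)) @ 1^'- -->
        (n%:R / (n%:R - 1) : R)].
Proof.
have cPhi n (s : R) (z : 'rV[R]_n) : z != 0 -> {for z, continuous (@Phi R n s)}.
  exact: continuous_cst_powR_enorm.
have cgrad n (s : R) (z : 'rV[R]_n) : z != 0 -> {for z, continuous (grad (@Phi R n s))}.
  exact: continuous_grad_Phi.
split; last 2 first.
- by split; [exact: cvg_Phi2|exact: cvg_grad_Phi2].
- move=> n n2; apply: cvg_at_left_filter.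
  have n20 : n%:R - 1 != 0 :> R by rewrite gt_eqF// subr_gt0 ltr1n.
  have nE : n%:R - 1 = n%:R - 2 * 1 + 1 :> R by ring.
  rewrite nE; apply: cvgM; first exact: cvg_cst.
  apply: cvgV; first by rewrite -nE.
  apply: cvgD; last exact: cvg_cst.
  apply: cvgB; first exact: cvg_cst.
  by apply: cvgM; [exact: cvg_cst|exact: cvg_id].
move=> n n3; rewrite Phi1E//; split; first exact: cvg_Phi.
move=> mu cs.
have ex_pot (s : R) (x : 'rV[R]_n) : ~ supp mu x -> potential_exists (@Phi R n s) mu x.
  by move=> xs; apply: potential_exists_off_supp => // z; exact: cPhi.
have ex_grad (s : R) (x : 'rV[R]_n) : ~ supp mu x -> vpotential_exists (grad (@Phi R n s)) mu x.
  move=> xs i; apply: potential_exists_off_supp => // z z0.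
  by apply: continuous_coord_comp; exact: cgrad.
split.
- by move=> s x _ xs; split; [exact: ex_pot|exact: ex_grad].
- by move=> x xs; split; [exact: ex_pot|exact: ex_grad].
- split.
    apply: cvg_potential_off_supp => //; [exact: cPhi|exact: cPhi|exact: cvg_Phi].
  apply: cvg_vpotential_off_supp => //; [exact: cgrad|exact: cgrad|exact: cvg_grad_Phi_ge3].
- move=> x _ [delta d01 fin].
  have [ex cv] := cvg_potential_Phi n3 d01 fin.
  have /andP[d0 d1] := d01.
  split.
  + apply: filterS (near_left1 (u := 1 - delta / 2) (v := 3 / 2) _) => //.
    by apply/andP; split; lra.
  + by apply: ex; apply/andP; split; lra.
  + exact: cvg_at_left_filter.
- move=> x _ [delta d01 fin].
  have H i := cvg_potential_grad_Phi n3 i d01 fin.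
  have /andP[d0 d1] := d01.
  split.
  + apply: filterS (near_left1 (u := 1 - delta / 2) (v := 3 / 2) _) => [s sI i|].
      exact: (H i).1.
    by apply/andP; split; lra.
  + by move=> i; apply: (H i).1; apply/andP; split; lra.
  (* The norm on rows is the sup norm, so finitely many coordinate estimates give the vector one. *)
  + apply/cvgrPdist_lt => e e0.
    have Hi (i : 'I_n) : \forall s \near 1^'-,
        `|potential (fun z => grad (@Phi R n 1) z ord0 i) mu x -
          potential (fun z => grad (@Phi R n s) z ord0 i) mu x| < e.
      have /cvgrPdist_lt := cvg_at_left_filter (H i).2.
      exact.
    apply: filterS (@filter_forall _ _ _ (1 : R)^'- _ Hi) => s Hs.
    by apply: ltr_row_norm => // i; rewrite !mxE; exact: Hs.
Qed.
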